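(* Let $d\in\mathbb{N}$, $1\le p\le\infty$, and $a,b\in\mathbb{R}$. Let $\mathbf{c}_k^H(a,b,p,d)\in[0,\infty]$ be the sharp (smallest) constant in the inequality $$\big\||x|^{-a}Hf(x)\big\|_{p,d\mu_k}\le\mathbf{c}_k^H(a,b,p,d)\,\big\||x|^bf(x)\big\|_{p,d\mu_k},\qquad Hf(x)=\int_{|y|\le|x|}f(y)\,d\mu_k(y).$$ The inequality holds with $\mathbf{c}_k^H(a,b,p,d)<\infty$ if and only if $\frac{a}{p'}>\frac{b}{p}$ and $a+b=d_k$. Moreover, in that case $$\mathbf{c}_k^H(a,b,p,d)=\frac{b_{\lambda_k}}{\frac{a}{p'}-\frac{b}{p}}.$$
   Context: $p'$ is the Hölder conjugate of $p$, $\frac1p+\frac1{p'}=1$ (with $\frac1\infty=0$). $R\subset\mathbb{R}^d\setminus\{0\}$ is a root system: a finite set with $R\cap\mathbb{R}a=\{a,-a\}$ and $\sigma_aR=R$ for all $a\in R$, where $\sigma_a$ is the reflection in the hyperplane $\langle a,x\rangle=0$; $R_+$ is a positive subsystem; $G(R)$ is the finite group generated by the $\sigma_a$; $k\colon R\to[0,\infty)$ is $G(R)$-invariant. Put $$v_k(x)=\prod_{a\in R_+}|\langle a,x\rangle|^{2k(a)},\quad c_k^{-1}=\int_{\mathbb{R}^d}e^{-|x|^2/2}v_k(x)\,dx,\quad d\mu_k(x)=c_kv_k(x)\,dx,$$ $$\lambda_k=\frac d2-1+\sum_{a\in R_+}k(a),\qquad d_k=2\lambda_k+2,\qquad b_{\lambda_k}=\frac{1}{2^{\lambda_k}\Gamma(\lambda_k+1)}.$$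 $\|f\|_{p,d\mu_k}=(\int_{\mathbb{R}^d}|f|^p\,d\mu_k)^{1/p}$ for $p<\infty$ and the essential supremum for $p=\infty$. The inequality is considered for all Lebesgue measurable $f$ on $\mathbb{R}^d$ with finite right-hand norm $\||x|^bf\|_{p,d\mu_k}$; its validity with a finite constant includes the requirement that the integral $Hf(x)$ converges absolutely for almost every $x$. *)

(* Defs.v *)
From HB Require Import structures.
From mathcomp Require Import all_boot all_order all_algebra finmap.
From mathcomp Require Import all_classical all_reals all_analysis.
From mathcomp Require Import measurable_realfun.

Set Implicit Arguments.
Unset Strict Implicit.
Unset Printing Implicit Defensive.
Import Order.TTheory GRing.Theory Num.Theory.
Import numFieldNormedType.Exports.

Local Open Scope classical_set_scope.
Local Open Scope ring_scope.

Section borel_structure.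
Context (R : realType) (n : nat).

Let coord (i : 'I_n) (x : 'rV[R]_n) : R := x ord0 i.

Let borel0 : g_sigma_preimage coord set0.
Proof. exact: sigma_algebra0. Qed.

Let borelC A : g_sigma_preimage coord A -> g_sigma_preimage coord (~` A).
Proof. exact: sigma_algebraC. Qed.

Let borel_bigcup (F : _^nat) : (forall i, g_sigma_preimage coord (F i)) ->
  g_sigma_preimage coord (\bigcup_i (F i)).
Proof. exact: sigma_algebra_bigcup. Qed.

Definition rV_display : measure_display -> measure_display.
Proof. exact. Qed.

HB.instance Definition _ := @isMeasurable.Build (rV_display default_measure_display)
  'rV[R]_n (g_sigma_preimage coord) borel0 borelC borel_bigcup.

Lemma measurable_coord (i : 'I_n) :
  measurable_fun [set: 'rV[R]_n] (fun x : 'rV[R]_n => x ord0 i).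
Proof.
move=> _ Y mY; rewrite setTI; apply: sub_sigma_algebra => /=.
rewrite -bigcup_seq/=; exists i => /=; first by rewrite mem_index_enum.
by exists Y => //; rewrite setTI.
Qed.

End borel_structure.

(* the n-fold product of the one-dimensional Lebesgue measure, on Borel sets,
   by slicing along the first coordinate *)
Fixpoint borel_lebesgue (R : realType) (n : nat) : set 'rV[R]_n -> \bar R :=
  match n with
  | 0%N => fun A => \d_(0 : 'rV[R]_0) A
  | m.+1 => fun A => (\int[@lebesgue_measure R]_x
      borel_lebesgue [set y : 'rV[R]_m | A (row_mx (x%:M : 'M[R]_1) y)])%E
  end.

Section borel_lebesgue_measure.
Context (R : realType).

Lemma measurable_fun_rV d (T : measurableType d) n (f : T -> 'rV[R]_n) :
  (forall i, measurable_fun setT (fun x => f x ord0 i)) ->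
  measurable_fun setT f.
Proof.
move=> mf _ A mA; rewrite setTI.
pose coord (i : 'I_n) (x : 'rV[R]_n) : R := x ord0 i.
suff : g_sigma_preimage coord `<=` [set B | measurable (f @^-1` B)] by exact.
apply: smallest_sub.
  split => /=; first by rewrite preimage_set0.
    by move=> B mB; rewrite setTD preimage_setC; exact: measurableC.
  by move=> F mF; rewrite preimage_bigcup; exact: bigcupT_measurable.
rewrite -bigcup_seq/= => B [i /= _ [C mC <-]]; rewrite setTI -comp_preimage.
by rewrite -[X in measurable X]setTI; exact: mf.
Qed.

(* the library proves this, but the canonical instance it declares is shadowed *)
Lemma sigma_finite_prod d1 d2 (T1 : measurableType d1) (T2 : measurableType d2)
    (m1 : {sigma_finite_measure set T1 -> \bar R})
    (m2 : {sigma_finite_measure set T2 -> \bar R}) :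
  sigma_finite setT (m1 \x m2)%E.
Proof.
have /sigma_finiteP[F [TF ndF Foo]] := sigma_finiteT m1.
have /sigma_finiteP[G [TG ndG Goo]] := sigma_finiteT m2.
exists (fun n => F n `*` G n).
  rewrite -setXTT TF TG predeqE => -[x y]; split.
    move=> [/= [n _ Fnx] [k _ Gky]]; exists (maxn n k) => //; split.
    - by move: x Fnx; exact/subsetPset/ndF/leq_maxl.
    - by move: y Gky; exact/subsetPset/ndG/leq_maxr.
  by move=> [n _ []/= ? ?]; split; exists n.
move=> k; have [? ?] := Foo k; have [? ?] := Goo k.
split; first exact: measurableX.
by rewrite product_measure1E// lte_mul_pinfty// ge0_fin_numE.
Qed.

Section cons.
Context (n : nat) (m : {sigma_finite_measure set 'rV[R]_n -> \bar R}).

Let cons (z : R * 'rV[R]_n) : 'rV[R]_n.+1 := row_mx (z.1%:M : 'M[R]_1) z.2.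
Let uncons (x : 'rV[R]_n.+1) : R * 'rV[R]_n :=
  (x ord0 ord0, \row_i x ord0 (lift ord0 i)).

Let cons0 z : cons z ord0 ord0 = z.1.
Proof.
transitivity (row_mx (z.1%:M : 'M[R]_1) z.2 ord0 (lshift n ord0)).
  by congr (fun_of_matrix _ _ _); exact: val_inj.
by rewrite row_mxEl mxE eqxx.
Qed.

Let consS z i : cons z ord0 (lift ord0 i) = z.2 ord0 i.
Proof.
transitivity (row_mx (z.1%:M : 'M[R]_1) z.2 ord0 (rshift 1 i)).
  by congr (fun_of_matrix _ _ _); exact: val_inj.
by rewrite row_mxEr.
Qed.

Let consK : cancel cons uncons.
Proof.
by case=> a v; rewrite /uncons cons0; congr pair; apply/rowP => i; rewrite mxE consS.
Qed.

Let measurable_cons : measurable_fun setT cons.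
Proof.
apply: measurable_fun_rV => i; case: (unliftP ord0 i) => [j|] ->.
  under eq_fun do rewrite consS.
  exact: (measurableT_comp (measurable_coord j) measurable_snd).
by under eq_fun do rewrite cons0; exact: measurable_fst.
Qed.

Let measurable_uncons : measurable_fun setT uncons.
Proof.
apply: measurable_fun_pair; first exact: measurable_coord.
apply: measurable_fun_rV => i; under eq_fun do rewrite mxE.
exact: measurable_coord.
Qed.

Let P := pushforward (@lebesgue_measure R \x m)%E cons.

Let P0 : P set0 = 0%E. Proof. by rewrite /P /pushforward preimage_set0 measure0. Qed.

Let P_ge0 A : (0 <= P A)%E. Proof. exact: measure_ge0. Qed.

Let P_sigma_additive : semi_sigma_additive P.
Proof.
pose Q : {measure set _ -> \bar R} := (@lebesgue_measure R \x m)%E.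
move=> F mF tF mUF; rewrite /P /pushforward preimage_bigcup.
apply: (@measure_semi_sigma_additive _ _ _ Q).
- by move=> k; rewrite -[X in measurable X]setTI; exact: measurable_cons.
- apply/trivIsetP => /= i j _ _ ij; rewrite -preimage_setI.
  by move/trivIsetP : tF => /(_ _ _ _ _ ij) ->//; rewrite preimage_set0.
- by rewrite -preimage_bigcup -[X in measurable X]setTI; exact: measurable_cons.
Qed.

HB.instance Definition _ := isMeasure.Build _ _ _ P P0 P_ge0 P_sigma_additive.

Let P_sigma_finite : sigma_finite setT P.
Proof.
have [F TF Foo] := sigma_finite_prod (@lebesgue_measure R) m.
exists (fun k => uncons @^-1` F k).
  by rewrite -preimage_bigcup -TF preimage_setT.
move=> k; have [mF Fk] := Foo k; split.
  by rewrite -[X in measurable X]setTI; exact: measurable_uncons.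
rewrite /P /pushforward -comp_preimage.
by rewrite (_ : uncons \o cons = id)//; apply/funext => z; exact: consK.
Qed.

HB.instance Definition _ := Measure_isSigmaFinite.Build _ _ _ P P_sigma_finite.

Lemma borel_lebesgue_cons : exists P' : {sigma_finite_measure set _ -> \bar R},
  forall A, P' A = (\int[@lebesgue_measure R]_x
    m [set y | A (row_mx (x%:M : 'M[R]_1) y)])%E.
Proof.
exists P => A; rewrite /= /P /pushforward /product_measure1.
apply: eq_integral => x _ /=; congr (m _); apply/seteqP; split=> y /=;
  by rewrite /xsection/= inE.
Qed.

End cons.

Lemma borel_lebesgue_sigma_finite_measure (n : nat) :
  exists m : {sigma_finite_measure set 'rV[R]_n -> \bar R},
    forall A, m A = borel_lebesgue A.
Proof.
elim: n => [|n [m mE]]; first by exists (\d_(0 : 'rV[R]_0)).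
have [P PE] := borel_lebesgue_cons m; exists P => A; rewrite PE /=.
by apply: eq_integral => x _; rewrite mE.
Qed.

Context (n : nat).

Let mu0 : @borel_lebesgue R n set0 = 0%E.
Proof.
by have [m mE] := borel_lebesgue_sigma_finite_measure n; rewrite -mE measure0.
Qed.

Let mu_ge0 A : (0 <= @borel_lebesgue R n A)%E.
Proof.
by have [m mE] := borel_lebesgue_sigma_finite_measure n; rewrite -mE measure_ge0.
Qed.

Let mu_sigma_additive : semi_sigma_additive (@borel_lebesgue R n).
Proof.
have [m mE] := borel_lebesgue_sigma_finite_measure n.
have -> : @borel_lebesgue R n = m by apply/funext => A; rewrite mE.
exact: measure_semi_sigma_additive.
Qed.

HB.instance Definition _ := isMeasure.Build _ _ _
  (@borel_lebesgue R n) mu0 mu_ge0 mu_sigma_additive.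

Let mu_sigma_finite : sigma_finite setT (@borel_lebesgue R n).
Proof.
have [m mE] := borel_lebesgue_sigma_finite_measure n.
have [F TF Foo] := @sigma_finiteT _ _ _ m.
by exists F => // k; have [mF Fk] := Foo k; split; rewrite -?mE.
Qed.

HB.instance Definition _ := Measure_isSigmaFinite.Build _ _ _
  (@borel_lebesgue R n) mu_sigma_finite.

End borel_lebesgue_measure.

(* The Lebesgue sigma-algebra on R^n (the completion of the Borel one) and the
   Lebesgue measure on it. *)
Notation lebesgue_rV_type R n :=
  (caratheodory_type (mu_ext (@borel_lebesgue R n))).

Definition lebesgue_rV (R : realType) (n : nat) :
    set (lebesgue_rV_type R n) -> \bar R :=
  @completed_measure_extension _ 'rV[R]_n R (@borel_lebesgue R n).

HB.instance Definition _ (R : realType) (n : nat) :=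
  Measure.on (@lebesgue_rV R n).

Arguments lebesgue_rV : clear implicits.

Section euclidean.
Context (R : realType) (d : nat).
Implicit Types x y a : 'rV[R]_d.

Definition dotv x y : R := \sum_(i < d) x ord0 i * y ord0 i.

(* the norm canonically attached to matrices is the sup norm *)
Definition enorm x : R := Num.sqrt (dotv x x).

Definition reflection a x : 'rV[R]_d := x - (2 * dotv a x / dotv a a) *: a.

Definition root_system (Phi : {fset 'rV[R]_d}) : Prop :=
  0 \notin Phi /\
  forall a, a \in Phi ->
    (forall b, (b \in Phi /\ exists t : R, b = t *: a) <-> (b = a \/ b = - a)) /\
    [fset reflection a b | b in Phi]%fset = Phi.

Definition positive_subsystem (Phi Phip : {fset 'rV[R]_d}) : Prop :=
  exists2 u : 'rV[R]_d, (forall a, a \in Phi -> dotv u a != 0) &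
    forall a, (a \in Phip) = (a \in Phi) && (0 < dotv u a).

Inductive reflection_group (Phi : {fset 'rV[R]_d}) :
    ('rV[R]_d -> 'rV[R]_d) -> Prop :=
| reflection_group_gen a : a \in Phi -> reflection_group Phi (reflection a)
| reflection_group_id : reflection_group Phi id
| reflection_group_comp g h : reflection_group Phi g ->
    reflection_group Phi h -> reflection_group Phi (g \o h)
| reflection_group_inv g h : reflection_group Phi g ->
    cancel g h -> cancel h g -> reflection_group Phi h.

(* the values of k outside Phi are irrelevant *)
Definition multiplicity_function (Phi : {fset 'rV[R]_d}) (k : 'rV[R]_d -> R) :
    Prop :=
  (forall a, a \in Phi -> 0 <= k a) /\
  (forall g a, reflection_group Phi g -> a \in Phi -> k (g a) = k a).

End euclidean.

Section dunkl_measure.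
Context (R : realType) (d : nat).
Variables (Phip : {fset 'rV[R]_d}) (k : 'rV[R]_d -> R).

Notation L := (lebesgue_rV_type R d).
Notation leb := (lebesgue_rV R d).

Definition dunkl_weight (x : 'rV[R]_d) : R :=
  \prod_(a <- Phip) (`|dotv a x| `^ (2 * k a)).

Definition dunkl_const : R :=
  (\int[leb]_x (expR (- (enorm x ^+ 2 / 2)) * dunkl_weight x))^-1.

Definition dunkl_measure (A : set L) : \bar R :=
  (\int[leb]_(x in A) (dunkl_const * dunkl_weight x)%:E)%E.

Let measurable_lcoord i : measurable_fun setT (fun x : L => (x : 'rV[R]_d) ord0 i).
Proof.
move=> _ Y mY; rewrite setTI; apply: caratheodory_measurable_mu_ext.
by rewrite -[X in measurable X]setTI; exact: (measurable_coord i).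
Qed.

Lemma measurable_dotv a : measurable_fun setT (fun x : L => dotv a x).
Proof.
apply: measurable_sum => i; apply: measurable_funM => //.
Qed.

Lemma measurable_dunkl_weight :
  measurable_fun setT (fun x : L => dunkl_weight x).
Proof.
apply: measurable_prod => a _.
apply: (measurableT_comp (@measurable_powR R (2 * k a)) _).
by apply: measurableT_comp => //; exact: measurable_dotv.
Qed.

Lemma dunkl_weight_ge0 x : 0 <= dunkl_weight x.
Proof. by apply: prodr_ge0 => a _; exact: powR_ge0. Qed.

Lemma dunkl_const_ge0 : 0 <= dunkl_const.
Proof.
rewrite invr_ge0; apply: Rintegral_ge0 => x _.
by rewrite mulr_ge0 ?expR_ge0 ?dunkl_weight_ge0.
Qed.

Let density_ge0 x : (0 <= (dunkl_const * dunkl_weight x)%:E)%E.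
Proof. by rewrite lee_fin mulr_ge0 ?dunkl_const_ge0 ?dunkl_weight_ge0. Qed.

Let dunkl_measure0 : dunkl_measure set0 = 0%E.
Proof. exact: integral_set0. Qed.

Let dunkl_measure_ge0 A : (0 <= dunkl_measure A)%E.
Proof. by apply: integral_ge0 => x _; exact: density_ge0. Qed.

Let dunkl_measure_sigma_additive : semi_sigma_additive dunkl_measure.
Proof.
move=> F mF tF mUF; rewrite /dunkl_measure ge0_integral_bigcup//.
  by apply: is_cvg_nneseries => *; exact: dunkl_measure_ge0.
  apply/measurable_EFinP/measurable_funM => //.
  exact: measurable_funS measurable_dunkl_weight.
Qed.

HB.instance Definition _ := isMeasure.Build _ _ _ dunkl_measure
  dunkl_measure0 dunkl_measure_ge0 dunkl_measure_sigma_additive.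

End dunkl_measure.

(* Euler's integral; it is the Gamma function for s > 0 *)
Definition Gamma (R : realType) (s : R) : R :=
  \int[@lebesgue_measure R]_(t in `]0, +oo[) (t `^ (s - 1) * expR (- t)).

Section hardy.
Context (R : realType) (d : nat).
Variables (Phip : {fset 'rV[R]_d}) (k : 'rV[R]_d -> R).

Notation L := (lebesgue_rV_type R d).
Notation leb := (lebesgue_rV R d).
Notation dunkl_measure := (dunkl_measure Phip k).

Definition dunkl_lambda : R := d%:R / 2 - 1 + \sum_(a <- Phip) k a.

Definition dunkl_dim : R := 2 * dunkl_lambda + 2.

Definition dunkl_b : R :=
  (2 `^ dunkl_lambda * Gamma (dunkl_lambda + 1))^-1.

Definition hardy_ball (x : 'rV[R]_d) : set L := [set y | enorm y <= enorm x].

Definition hardy_op (f : 'rV[R]_d -> R) (x : 'rV[R]_d) : R :=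
  \int[dunkl_measure]_(y in hardy_ball x) f y.

(* at the origin, a null point, [`^] yields 1 if s = 0 and 0 otherwise *)
Definition weighted_norm (s : R) (p : \bar R) (f : 'rV[R]_d -> R) : \bar R :=
  Lnorm dunkl_measure p (fun x : L => (enorm x `^ s * f x)%:E).

(* [hardy_op f] takes junk values where the integral does not converge
   absolutely, whence the first conjunct *)
Definition hardy_inequality (a b : R) (p : \bar R) (C : R) : Prop :=
  forall f : 'rV[R]_d -> R, measurable_fun (setT : set L) f ->
    (weighted_norm b p f < +oo)%E ->
    (\forall x \ae leb,
       dunkl_measure.-integrable (hardy_ball x) (fun y => (f y)%:E)) /\
    (weighted_norm (- a) p (hardy_op f) <= C%:E * weighted_norm b p f)%E.

(* +oo when no finite constant is valid *)
Definition hardy_const (a b : R) (p : \bar R) : \bar R :=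
  ereal_inf [set C%:E | C in [set C : R | 0 <= C /\ hardy_inequality a b p C]].

End hardy.

(* Main.v *)
Require Import Defs.
From HB Require Import structures.
From mathcomp Require Import all_boot all_order all_algebra finmap.
From mathcomp Require Import all_classical all_reals all_analysis.
From mathcomp Require Import measurable_realfun.
From mathcomp Require Import ring lra.

Set Implicit Arguments.
Unset Strict Implicit.
Unset Printing Implicit Defensive.
Import Order.TTheory GRing.Theory Num.Theory.
Import numFieldNormedType.Exports.

Local Open Scope classical_set_scope.
Local Open Scope ring_scope.

(** The operator [H] only sees [f] through integrals over balls, and the measure
[mu_k] enters only through the mass of the balls: [mu_k (|x| <= r)] is
[b / d_k * r `^ d_k] with [b = b_{lambda_k}]. The inequality is therefore
proved on any measure space with a nonnegative measurable function [N] such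
that [mu (N <= r) = B / D * r `^ D]; the image of [mu] under [N] then has
density [B r `^ (D - 1)] ([ge0_integral_radial]), so that integrals of powers
of [N] over balls and their complements are explicit. Write
[kappa = a / p' - b / p].

Necessity and lower bound ([hardy_necessary]): test the inequality on
[f = N `^ s] cut off at [N <= r]. Then [H f] is a power of [N] on the ball, and
both norms are multiples of powers of [r]. Comparing the exponents over all
[r > 0] gives [a + b = D]. After that the two truncated powers coincide and the
inequality reads [B / u <= C] with [u = s + D]; every [u > max(kappa, 0)]
arises, and this forces [kappa > 0] and [B / kappa <= C].

Upper bound ([hardy_sufficient_real]): for finite [p] this is Schur's test,
that is, Hoelder's inequality on the ball [N y <= N x] with the splitting
[|f| = (N `^ gam |f|) * N `^ (- gam)], [gam = b + kappa / p], followed by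
Tonelli's theorem on the triangle [N y <= N x]. The two explicit integrals
contribute [(B / kappa) `^ (p - 1)] and [B / kappa]. For [p = +oo]
([hardy_sufficient_infty]) one integrates the bound [|f| <= M N `^ (- b)].

Mass of the balls ([dunkl_measure_ball]): the weight is homogeneous of degree
[2 * \sum_a k a] and Lebesgue measure of degree [d], whence the mass
[K * r `^ d_k] before normalization. The weight is bounded on the ball, so
[K] is finite; it is positive on a small cube in the chamber of [Phip], so [K]
is not zero. The same radial formula, used with [N = |x|^2 / 2], turns the
Gaussian integral defining [c_k] into [Gamma (lambda_k + 1)], and [K] cancels. *)

(** * Images, densities and monotonicity *)

Section sigma_finite_bundle.
Context d (T : measurableType d) (R : realType).
Variables (mu : {measure set T -> \bar R}) (sf : sigma_finite setT mu).

Let P (A : set T) : \bar R := mu A.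
Let P0 : P set0 = 0%E. Proof. exact: measure0. Qed.
Let P_ge0 A : (0 <= P A)%E. Proof. exact: measure_ge0. Qed.
Let P_sigma_additive : semi_sigma_additive P.
Proof. exact: measure_semi_sigma_additive. Qed.
HB.instance Definition _ := isMeasure.Build _ _ _ P P0 P_ge0 P_sigma_additive.
Let P_sigma_finite : sigma_finite setT P. Proof. exact: sf. Qed.
HB.instance Definition _ := Measure_isSigmaFinite.Build _ _ _ P P_sigma_finite.

(** Tonelli's theorem takes sigma-finiteness from the structure of the measure,
    not from a hypothesis. *)
Lemma sigma_finite_measure_exists :
  exists nu : {sigma_finite_measure set T -> \bar R}, forall A, nu A = mu A.
Proof. by exists P. Qed.

End sigma_finite_bundle.

Lemma image_measure_exists d1 d2 (X : measurableType d1) (Y : measurableType d2)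
    (R : realType) (mu : {measure set X -> \bar R}) (f : X -> Y) :
  measurable_fun setT f ->
  exists nu : {measure set Y -> \bar R},
    (forall A, nu A = mu (f @^-1` A)) /\
    (forall g : Y -> \bar R, measurable_fun setT g -> (forall y, 0 <= g y)%E ->
      (\int[nu]_y g y = \int[mu]_x g (f x))%E).
Proof.
move=> mf.
(* Inference cannot supply [mf], so the measure structure is named. *)
exists (measure_function_pushforward__canonical__measure_function_Measure mu mf).
by split => // g mg g0; rewrite ge0_integral_pushforward.
Qed.

Section densities.
Local Open Scope ereal_scope.
Context d (T : measurableType d) (R : realType).
Variable mu : {measure set T -> \bar R}.

Section density_measure.
Variable w : T -> R.
Hypotheses (mw : measurable_fun setT w) (w0 : forall x, (0 <= w x)%R).

Let nu (A : set T) : \bar R := \int[mu]_(x in A) (w x)%:E.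

Let nu0 : nu set0 = 0. Proof. exact: integral_set0. Qed.

Let nu_ge0 A : 0 <= nu A.
Proof. by apply: integral_ge0 => x _; rewrite lee_fin. Qed.

Let nu_sigma_additive : semi_sigma_additive nu.
Proof.
move=> F mF tF mUF; rewrite /nu ge0_integral_bigcup//.
- by apply: is_cvg_nneseries => *; exact: nu_ge0.
- by apply/measurable_EFinP; exact: measurable_funS mw.
- by move=> x _; rewrite lee_fin.
Qed.

HB.instance Definition _ := isMeasure.Build _ _ _ nu nu0 nu_ge0 nu_sigma_additive.

Lemma density_measure_exists : exists nu : {measure set T -> \bar R},
  forall A, nu A = \int[mu]_(x in A) (w x)%:E.
Proof. by exists nu. Qed.

End density_measure.

Import HBNNSimple.

(** The hypothesis is the claim for indicator functions; it passes to simple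
    functions by linearity and to [f] by monotone convergence. *)
Lemma ge0_integral_density (nu : {measure set T -> \bar R}) (w : T -> R)
    (f : T -> \bar R) :
  measurable_fun setT w -> (forall x, (0 <= w x)%R) ->
  (forall A, measurable A -> nu A = \int[mu]_(x in A) (w x)%:E) ->
  measurable_fun setT f -> (forall x, 0 <= f x) ->
  \int[nu]_x f x = \int[mu]_x (f x * (w x)%:E).
Proof.
move=> mw w0 nuE mf f0.
pose h := nnsfun_approx measurableT mf.
have mwE : measurable_fun setT (EFin \o w) by exact/measurable_EFinP.
have -> : \int[nu]_x f x = lim (\int[nu]_x (EFin \o h n) x @[n --> \oo]).
  have fE x : f x = lim ((EFin \o h n) x @[n --> \oo]).
    by apply/esym/cvg_lim => //; exact: cvg_nnsfun_approx.
  under eq_integral => x _ do rewrite fE //.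
  apply: monotone_convergence => //.
  - by move=> n; apply/measurable_EFinP; exact/measurable_funP.
  - by move=> n x _ //=; rewrite lee_fin.
  - by move=> x _ a b ab; rewrite lee_fin; exact/lefP/nd_nnsfun_approx.
have -> : \int[mu]_x (f x * (w x)%:E) =
    lim (\int[mu]_x ((EFin \o h n) \* (EFin \o w)) x @[n --> \oo]).
  have fg x : f x * (w x)%:E = lim (((EFin \o h n) \* (EFin \o w)) x @[n --> \oo]).
    by apply/esym/cvg_lim => //; apply: cvgeZr => //; exact: cvg_nnsfun_approx.
  under eq_integral => x _ do rewrite fg //.
  apply: monotone_convergence => [//| | |].
  - by move=> n; apply/emeasurable_funM => //; exact/measurable_EFinP.
  - by move=> n x _ /=; rewrite mule_ge0 ?lee_fin.
  - move=> x _ a b ab/=; rewrite lee_wpmul2r ?lee_fin//.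
    exact/lefP/nd_nnsfun_approx.
suff suf n : \int[nu]_x (EFin \o h n) x =
    \int[mu]_x ((EFin \o h n) \* (EFin \o w)) x by under eq_fun do rewrite suf.
transitivity (\int[nu]_x
   (\sum_(y \in range (h n)) (y * \1_(h n @^-1` [set y]) x)%:E)).
  by apply: eq_integral => t tE; rewrite /= fimfunE -fsumEFin.
have indich m r : measurable_fun setT (fun x => (r * \1_(h m @^-1` [set r]) x)%:E).
  by apply: (measurable_comp measurableT) => //; exact: measurable_funM.
rewrite ge0_integral_fsum//; last by move=> m y _; exact: nnfun_muleindic_ge0.
transitivity (\int[mu]_x (\sum_(y \in range (h n))
    (y * \1_(h n @^-1` [set y]) x)%:E * (w x)%:E)); last first.
  under [LHS]eq_integral => x xE.
    rewrite -ge0_mule_fsuml => [|y]; last exact: nnfun_muleindic_ge0.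
    rewrite fsumEFin // -(fimfunE _ x); over.
  by [].
rewrite ge0_integral_fsum//; last 2 first.
  - by move=> y; apply: emeasurable_funM.
  - by move=> m y _; rewrite mule_ge0 ?lee_fin// -lee_fin nnfun_muleindic_ge0.
apply: eq_fsbigr => r rhn.
under eq_integral do rewrite EFinM.
rewrite integralZl_indic_nnsfun => //.
under [RHS]eq_integral do rewrite EFinM -muleA.
rewrite [RHS]ge0_integralZl//.
- under [in RHS]eq_integral do rewrite muleC.
  rewrite [in RHS](eq_integral ((EFin \o w) \_ (h n @^-1` [set r]))); last first.
    by move=> x xE; rewrite epatch_indic.
  by rewrite -integral_mkcond -nuE// integral_indic// setIT.
- by apply: emeasurable_funM => //; exact/measurable_EFinP.
- by move=> t Et; rewrite mule_ge0 ?lee_fin.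
- by move: rhn; rewrite inE => -[t _ <-]; rewrite lee_fin.
Qed.

(** Integrals of nonnegative functions are suprema over the simple functions
    below, so monotonicity needs no measurability. *)
Lemma ge0_le_integralT (f g : T -> \bar R) :
  (forall x, 0 <= f x) -> (forall x, f x <= g x) ->
  \int[mu]_x f x <= \int[mu]_x g x.
Proof.
move=> f0 fg; have g0 x : 0 <= g x by exact: le_trans (fg x).
rewrite !ge0_integralTE//; apply: le_ereal_sup => _ [h hf <-].
by exists h => // x; exact: le_trans (fg x).
Qed.

End densities.

(** * Integrals of powers on the half-line *)

Lemma powRV (R : realType) (x q : R) : 0 <= x -> x^-1 `^ q = x `^ (- q).
Proof. by move=> x0; rewrite -powR_inv1// -powRrM mulN1r. Qed.

Section power_integrals.
Context {R : realType}.
Local Notation leb := (@lebesgue_measure R).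
Implicit Types q s t r : R.

Lemma integral_powR_itvcc q s t : q != 0 -> 0 < s -> s <= t ->
  (\int[leb]_(x in `[s, t]) (x `^ (q - 1))%:E = ((t `^ q - s `^ q) / q)%:E)%E.
Proof.
move=> q0 s0; rewrite le_eqVlt => /predU1P[->|st].
  by rewrite set_itv1 integral_set1 subrr mul0r.
have D (x : R) : 0 < x ->
    is_derive x 1 (fun x : R => q^-1 * x `^ q) (x `^ (q - 1)).
  move=> x0; apply: (is_derive_eq (is_deriveZ q^-1 (is_derive1_powR q x0))).
  by rewrite /GRing.scale/= mulrA mulVf// mul1r.
have C (x : R) : 0 < x -> {for x, continuous (fun x : R => q^-1 * x `^ q)}.
  move=> x0; apply/differentiable_continuous/derivable1_diffP.
  by apply: ex_derive; exact: D.
rewrite (continuous_FTC2 (F := fun x : R => q^-1 * x `^ q) st).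
- by rewrite -EFinB -mulrBr mulrC.
- apply: derivable_within_continuous => x; rewrite in_itv/= => /andP[sx _].
  by apply: derivable_powR; rewrite in_itv/= andbT; exact: lt_le_trans sx.
- split.
  + move=> x; rewrite in_itv/= => /andP[sx _].
    by apply: ex_derive; apply: D; exact: lt_trans sx.
  + by apply: cvg_at_right_filter; exact: C.
  + by apply: cvg_at_left_filter; apply: C; exact: lt_trans st.
- move=> x; rewrite in_itv/= => /andP[sx _].
  by rewrite derive1E; have [_ ->] := D x (lt_trans s0 sx).
Qed.

Lemma cvg_powR_nat q : 0 < q -> (n.+1%:R : R) `^ (- q) @[n --> \oo] --> (0 : R).
Proof.
move=> q0; have -> : (fun n => (n.+1%:R : R) `^ (- q)) = (fun n => (@harmonic R n) `^ q).
  by apply/funext => n; rewrite /harmonic powRV.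
have /cvg_at_rightP := powR_cvg0 q0; apply; split; last exact: cvg_harmonic.
by move=> n; rewrite /harmonic/= invr_gt0.
Qed.

(** Common to both ends of the half-line: exhausting [`]0, t]] by
    [`[t / n.+1, t]], or [`[t, +oo[] by [`[t, t * n.+1]], the partial integrals
    miss the limit [T] by the fraction [n.+1 `^ (- q)] of it. *)
Let integral_powR_exhaust q T (I : set R) (F : (set R)^nat) : 0 < q ->
  measurable I -> (forall n, measurable (F n)) ->
  {homo F : m n / (m <= n)%N >-> (m <= n)%O} -> \bigcup_n F n = I ->
  forall r : R, (forall n, (\int[leb]_(x in F n) (x `^ (r - 1))%:E =
    (T * (1 - n.+1%:R `^ (- q)))%:E)%E) ->
  (\int[leb]_(x in I) (x `^ (r - 1))%:E = T%:E)%E.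
Proof.
move=> q0 mI mF ndF FI r intF.
have mw : measurable_fun setT (fun x : R => x `^ (r - 1)) by exact: measurable_powR.
have [nu nuE] := density_measure_exists leb mw (fun=> powR_ge0 _ _).
rewrite -nuE -FI.
have mUF : measurable (\bigcup_n F n) by rewrite FI.
have := nondecreasing_cvg_mu (mu := nu) mF mUF ndF; move/cvg_lim => <-//.
apply/cvg_lim => //.
have -> : nu \o F = EFin \o (fun n => T * (1 - n.+1%:R `^ (- q))).
  by apply/funext => n /=; rewrite nuE intF.
apply: cvg_EFin; first by apply: nearW.
rewrite -[X in _ --> X]mulr1; apply: cvgMr => //.
rewrite -[X in _ --> X]subr0; apply: cvgB; first exact: cvg_cst.
exact: cvg_powR_nat.
Qed.

Lemma integral_powR_itvoc q t : 0 < q -> 0 <= t ->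
  (\int[leb]_(x in `]0%R, t]) (x `^ (q - 1))%:E = (t `^ q / q)%:E)%E.
Proof.
move=> q0; rewrite le_eqVlt => /predU1P[<-|t0].
  by rewrite set_itvoc0 integral_set0 powR0 ?gt_eqF// mul0r.
apply: (@integral_powR_exhaust q _ _ (fun n => `[t / n.+1%:R, t]%classic)) => //.
- move=> m n mn; apply/subsetPset => x/=; rewrite !in_itv/= => /andP[+ ->].
  rewrite andbT; apply: le_trans; rewrite ler_pM2l// lef_pV2 ?posrE//.
  by rewrite ler_nat.
- apply/seteqP; split => x/=.
    move=> [n _ /=]; rewrite !in_itv/= => /andP[+ ->]; rewrite andbT.
    by apply: lt_le_trans; rewrite divr_gt0.
  rewrite !in_itv/= => /andP[x0 xt].
  exists (Num.truncn (t / x)) => //=; rewrite in_itv/= xt andbT.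
  by rewrite ler_pdivrMr// mulrC -ler_pdivrMr// ltW// truncnS_gt.
- move=> n; rewrite integral_powR_itvcc ?gt_eqF ?divr_gt0//; last first.
    by rewrite ler_pdivrMr// ler_peMr ?ler1n// ltW.
  rewrite powRM ?invr_ge0 ?(ltW t0)// powRV//; congr EFin.
  by rewrite mulrBr mulr1 mulrBl [in RHS]mulrAC.
Qed.

Lemma integral_powR_itvcy q t : 0 < q -> 0 < t ->
  (\int[leb]_(x in `[t, +oo[) (x `^ (- q - 1))%:E = (t `^ (- q) / q)%:E)%E.
Proof.
move=> q0 t0.
apply: (@integral_powR_exhaust q _ _ (fun n => `[t, t * n.+1%:R]%classic)) => //.
- move=> m n mn; apply/subsetPset => x/=; rewrite !in_itv/= => /andP[->]/=.
  by move/le_trans; apply; rewrite ler_pM2l// ler_nat.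
- apply/seteqP; split => x/=.
    by move=> [n _ /=]; rewrite !in_itv/= => /andP[->].
  rewrite !in_itv/= andbT => tx.
  exists (Num.truncn (x / t)) => //=; rewrite in_itv/= tx/=.
  by rewrite mulrC -ler_pdivrMr// ltW// truncnS_gt.
- move=> n; rewrite integral_powR_itvcc ?oppr_eq0 ?gt_eqF//; last first.
    by rewrite ler_peMr ?ler1n// ltW.
  rewrite powRM ?(ltW t0)//; congr EFin.
  by rewrite invrN mulrN -mulNr opprB mulrBr mulr1 mulrBl [in RHS]mulrAC.
Qed.

End power_integrals.

(** * Radial integrals *)

(** Differences of rays are the half-open intervals, a pi-system that generates
    the Borel sets. *)
Lemma measure_eq_rays (R : realType) (m1 m2 : {measure set (measurableTypeR R) -> \bar R}) :
  (forall r : R, m1 `]-oo, r]%classic = m2 `]-oo, r]%classic) ->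
  (forall r : R, (m1 `]-oo, r]%classic < +oo)%E) ->
  forall A, measurable A -> m1 A = m2 A.
Proof.
move=> m12 m1y.
have cutE (a b : R) : `]a, b]%classic = `]-oo, b]%classic `\` `]-oo, a]%classic.
  apply/seteqP; split => x /=; rewrite !in_itv/=.
    by move=> /andP[ax ->]; split => //; apply/negP; rewrite -ltNge.
  by move=> [->]; rewrite andbT => /negP; rewrite -ltNge.
have cover : \bigcup_k `](- k%:R : R), k%:R]%classic = [set: R].
  apply/seteqP; split => // x _; exists (Num.truncn `|x|).+1 => //=.
  have := truncnS_gt `|x|; rewrite ltr_norml in_itv/= => /andP[h1 h2].
  by apply/andP; split; [exact: h1|exact: ltW h2].
apply: (@measure_unique _ _ (measurableTypeR R) (@ocitv R)
  (fun k => `](- k%:R : R), k%:R]%classic)).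
- by [].
- exact: ocitvI.
- by move=> k; exact: is_ocitv.
- exact: cover.
- move=> _ [[a b] _ <-]/=; rewrite cutE.
  have m2y (r : R) : (m2 `]-oo, r]%classic < +oo)%E by rewrite -m12.
  rewrite !measureD//=.
  suff -> : `]-oo, b] `&` `]-oo, a] = `]-oo, Num.min b a]%classic by rewrite !m12.
  by apply/seteqP; split => x /=; rewrite !in_itv/= le_min => /andP.
- move=> k; apply: le_lt_trans (m1y k%:R); apply: le_measure; rewrite ?inE//.
  by move=> x/=; rewrite !in_itv/= => /andP[].
Qed.

Section radial_integrals.
Context d (T : measurableType d) (R : realType).
Variables (mu : {measure set T -> \bar R}) (N : T -> R) (B D : R).
Hypotheses (mN : measurable_fun setT N) (N0 : forall x, 0 <= N x).
Hypotheses (D0 : 0 < D) (B0 : 0 <= B).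
(* With this constant the image of [mu] under [N] has density [B r `^ (D - 1)]. *)
Hypothesis muN : forall r, 0 <= r ->
  mu [set x | N x <= r] = (B / D * r `^ D)%:E.
Local Notation leb := (@lebesgue_measure R).

Let w (r : R) : R := B * r `^ (D - 1) * \1_(`]0, +oo[%classic : set R) r.

Let w0 r : 0 <= w r. Proof. by rewrite !mulr_ge0// ?powR_ge0. Qed.

Let mw : measurable_fun setT w.
Proof.
apply: measurable_funM; last exact: measurable_indic.
by apply: measurable_funM => //; exact: measurable_powR.
Qed.

Let integral_w (r : R) : 0 <= r ->
  (\int[leb]_(x in `]-oo, r]) (w x)%:E = (B / D * r `^ D)%:E)%E.
Proof.
move=> r0.
have -> : (B / D * r `^ D)%:E = (B%:E * (r `^ D / D)%:E)%E.
  by rewrite -EFinM mulrCA mulrC.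
rewrite -integral_powR_itvoc// -ge0_integralZl//; last 2 first.
- by apply/measurable_EFinP; apply: measurable_funTS; exact: measurable_powR.
- by move=> x _; rewrite lee_fin powR_ge0.
rewrite [LHS]integral_mkcond [RHS]integral_mkcond; apply: eq_integral => x _.
rewrite !patchE /w indicE !mem_setE !in_itv/= andbT.
by case: (ltP 0 x) => x0; rewrite ?mulr1 ?mulr0 ?if_same.
Qed.

(** The image of [mu] under [N] has density [B r `^ (D - 1)]: both measures
    give the same mass to every ray. *)
Lemma ge0_integral_radial (phi : R -> \bar R) :
  measurable_fun setT phi -> (forall r, 0 <= phi r)%E ->
  (\int[mu]_x phi (N x) =
   \int[leb]_(r in `]0%R, +oo[) (phi r * (B * r `^ (D - 1))%:E))%E.
Proof.
move=> mphi phi0.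
have [nu nuE] := density_measure_exists leb mw w0.
have [P [PmuE intP]] := image_measure_exists (Y := measurableTypeR R) mu mN.
have PE (r : R) : P `]-oo, r]%classic = nu `]-oo, r]%classic.
  have -> : P `]-oo, r]%classic = mu [set x | N x <= r].
    by rewrite PmuE; congr (mu _); apply/seteqP; split => x /=; rewrite in_itv.
  rewrite nuE; have [r0|r0] := leP 0 r; first by rewrite muN// integral_w.
  rewrite (_ : [set x | N x <= r] = set0) ?measure0.
    rewrite integral0_eq// => x /=; rewrite in_itv/= => xr.
    rewrite /w indicE mem_setE in_itv/= andbT.
    by rewrite ltNge (le_trans xr (ltW r0)) mulr0.
  by apply/seteqP; split => x //=; rewrite leNgt (lt_le_trans r0).
have Pnu : forall A : set R, measurable A -> P A = nu A.
  apply: (measure_eq_rays PE) => r; rewrite PE nuE.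
  have r0 : 0 <= Num.max r 0 by rewrite le_max lexx orbT.
  have := ltry (B / D * Num.max r 0 `^ D); rewrite -(integral_w r0).
  apply: le_lt_trans; apply: ge0_subset_integral => //.
  - by apply/measurable_EFinP; exact: measurable_funTS.
  - by move=> x _; rewrite lee_fin.
  - by move=> x/=; rewrite !in_itv/= le_max => ->.
rewrite -intP//.
rewrite (eq_measure_integral nu) => [|A mA _]; last exact: Pnu.
rewrite (ge0_integral_density (mu := leb) (w := w))//.
rewrite [RHS]integral_mkcond; apply: eq_integral => r _.
by rewrite patchE /w indicE; case: ifP => _; rewrite ?mulr1 ?mulr0 ?mule0.
Qed.

Lemma integral_powR_ball (s r : R) : 0 < s + D -> 0 <= r ->
  (\int[mu]_(x in [set x | (N x <= r)%R]) (N x `^ s)%:E =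
   (B / (s + D) * r `^ (s + D))%:E)%E.
Proof.
move=> sD0 r0.
pose phi : R -> \bar R := (fun x => (x `^ s)%:E) \_ (`]-oo, r]%classic : set R).
rewrite integral_mkcond (_ : _ \_ _ = phi \o N); last first.
  apply/funext => x; rewrite /phi/= !patchE.
  suff -> : (x \in [set x | N x <= r]) = (N x \in `]-oo, r]%classic) by [].
  by apply/idP/idP => /set_mem/=; rewrite ?in_itv => xr; apply/mem_set; rewrite /= ?in_itv.
rewrite ge0_integral_radial.
- have -> : (B / (s + D) * r `^ (s + D))%:E = (B%:E * (r `^ (s + D) / (s + D))%:E)%E.
    by rewrite -EFinM mulrCA mulrC.
  rewrite -integral_powR_itvoc// -ge0_integralZl//; last 2 first.
  + by apply/measurable_EFinP; apply: measurable_funTS; exact: measurable_powR.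
  + by move=> x _; rewrite lee_fin powR_ge0.
  rewrite [LHS]integral_mkcond [RHS]integral_mkcond; apply: eq_integral => x _.
  rewrite /phi !patchE !mem_setE !in_itv/= andbT.
  case: (ltP 0 x) => x0 //=; case: ifP => _; rewrite ?mul0e//.
  rewrite -!EFinM mulrCA -powRD; first by rewrite addrA.
  by rewrite [x == 0]gt_eqF ?implybT.
- apply/(measurable_restrictT _ _).1 => //.
  by apply/measurable_EFinP; apply: measurable_funTS; exact: measurable_powR.
- by move=> x; apply: erestrict_ge0 => y _; rewrite lee_fin powR_ge0.
Qed.

Lemma integral_powR_coball (s r : R) : s + D < 0 -> 0 < r ->
  (\int[mu]_(x in [set x | (r <= N x)%R]) (N x `^ s)%:E =
   (B / - (s + D) * r `^ (s + D))%:E)%E.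
Proof.
move=> sD0 r0.
pose phi : R -> \bar R := (fun x => (x `^ s)%:E) \_ (`[r, +oo[%classic : set R).
rewrite integral_mkcond (_ : _ \_ _ = phi \o N); last first.
  apply/funext => x; rewrite /phi/= !patchE.
  suff -> : (x \in [set x | r <= N x]) = (N x \in `[r, +oo[%classic) by [].
  apply/idP/idP => /set_mem/=; rewrite ?in_itv/= ?andbT => xr; apply/mem_set.
    by rewrite /= in_itv/= andbT.
  by [].
rewrite ge0_integral_radial.
- have -> : (B / - (s + D) * r `^ (s + D))%:E =
      (B%:E * (r `^ (- - (s + D)) / - (s + D))%:E)%E.
    by rewrite -EFinM opprK mulrCA mulrC.
  rewrite -integral_powR_itvcy ?oppr_gt0// -ge0_integralZl//; last 2 first.
  + by apply/measurable_EFinP; apply: measurable_funTS; exact: measurable_powR.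
  + by move=> x _; rewrite lee_fin powR_ge0.
  rewrite [LHS]integral_mkcond [RHS]integral_mkcond; apply: eq_integral => x _.
  rewrite /phi !patchE !mem_setE !in_itv/= !andbT.
  case: (leP r x) => rx; rewrite ?mul0e ?if_same//.
  rewrite (lt_le_trans r0 rx) -!EFinM mulrCA -powRD; first by rewrite opprK addrA.
  by rewrite [x == 0]gt_eqF ?implybT ?(lt_le_trans r0 rx).
- apply/(measurable_restrictT _ _).1 => //.
  by apply/measurable_EFinP; apply: measurable_funTS; exact: measurable_powR.
- by move=> x; apply: erestrict_ge0 => y _; rewrite lee_fin powR_ge0.
Qed.

End radial_integrals.

(** * Norms of truncated powers *)

Section Lnorm_facts.
Local Open Scope ereal_scope.
Context d (T : measurableType d) (R : realType).
Variable mu : {measure set T -> \bar R}.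

Lemma Lnorm_EFin (p : R) (f : T -> R) :
  'N[mu]_p%:E[EFin \o f] = (\int[mu]_x (`|f x| `^ p)%:E) `^ p^-1.
Proof. by rewrite unlock. Qed.

Lemma le_Lnorm (p : \bar R) (f g : T -> \bar R) : 1 <= p ->
  (forall x, `|f x| <= `|g x|) -> 'N[mu]_p[f] <= 'N[mu]_p[g].
Proof.
move=> p1 fg; rewrite unlock; case: p p1 => [p||//].
- rewrite lee_fin => p1; have p0 : (0 <= p)%R by exact: le_trans p1.
  apply: gt0_ler_poweR; rewrite ?invr_ge0 ?in_itv/= ?andbT ?leey ?andbT//.
  + by apply: integral_ge0 => x _; exact: poweR_ge0.
  + by apply: integral_ge0 => x _; exact: poweR_ge0.
  + apply: ge0_le_integralT => x; first exact: poweR_ge0.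
    by apply: gt0_ler_poweR; rewrite ?in_itv/= ?leey ?abse_ge0.
- move=> _; case: ifPn => // mu0; apply: ess_sup_inf.le_ess_sup.
  by apply: nearW => x /=; exact: fg.
Qed.

Lemma LnormZl (p : \bar R) (A : R) (f : T -> R) : 1 <= p -> (0 <= A)%R ->
  measurable_fun setT f ->
  'N[mu]_p[EFin \o (fun x => A * f x)%R] = A%:E * 'N[mu]_p[EFin \o f].
Proof.
move=> p1 A0 mf; case: p p1 => [p||//].
- rewrite lee_fin => p1; have p0 : (0 < p)%R by exact: lt_le_trans p1.
  rewrite !Lnorm_EFin; under eq_integral do rewrite normrM powRM// EFinM.
  rewrite ge0_integralZl//; last first.
    apply/measurable_EFinP; apply: (measurableT_comp (measurable_powR p)).
    exact: measurableT_comp.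
  rewrite poweRM ?lee_fin ?powR_ge0//; last first.
    by apply: integral_ge0 => x _; rewrite lee_fin powR_ge0.
  by rewrite poweR_EFin -powRrM mulfV ?gt_eqF// powRr1 ?ger0_norm.
- move=> _; rewrite unlock; case: ifPn => mu0; last by rewrite mule0.
  rewrite -ess_sup_inf.ess_supZl//; congr (ess_sup_inf.ess_sup _ _).
  by apply/funext => x /=; rewrite normrM EFinM (ger0_norm A0).
Qed.

End Lnorm_facts.

Section radial_hardy.
Context d (T : measurableType d) (R : realType).
Variables (mu : {measure set T -> \bar R}) (N : T -> R) (B D : R).
Hypotheses (mN : measurable_fun setT N) (N0 : forall x, 0 <= N x).
Hypotheses (D0 : 0 < D) (B0 : 0 < B).
Hypothesis muN : forall r, 0 <= r ->
  mu [set x | N x <= r] = (B / D * r `^ D)%:E.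

Lemma measurable_radial_ball r : measurable [set x | N x <= r].
Proof.
rewrite (_ : [set x | _] = setT `&` N @^-1` `]-oo, r]%classic); first exact: mN.
by rewrite setTI; apply/seteqP; split => x /=; rewrite in_itv.
Qed.

Let origin_negligible : mu [set x | N x <= 0] = 0%E.
Proof. by rewrite muN// powR0 ?mulr0// gt_eqF. Qed.

Let measurable_powN s : measurable_fun setT (fun x => N x `^ s).
Proof. exact: (measurableT_comp (measurable_powR s) mN). Qed.

Let mu_setT_gt0 : (0 < mu setT)%E.
Proof.
apply: (@lt_le_trans _ _ (mu [set x | N x <= 1])).
  by rewrite muN// powR1 mulr1 lte_fin divr_gt0.
by apply: le_measure; rewrite ?inE//; exact: measurable_radial_ball.
Qed.

(** Powers of [N] truncated to a ball. Cutting out the origin makes the rules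
    for exponents valid at every point. *)
Definition truncated_power (s r : R) x : R := N x `^ s * (0 < N x <= r)%R%:R.

Lemma measurable_truncated_power s r : measurable_fun setT (truncated_power s r).
Proof.
rewrite /truncated_power; under eq_fun => x.
  rewrite (_ : _%:R = \1_([set x | N x <= r] `\` [set x | N x <= 0]) x); last first.
    rewrite indicE; congr (nat_of_bool _)%:R.
    apply/idP/idP => [/andP[x0 xr]|/set_mem/= [-> /negP]].
      by apply/mem_set; split => //=; apply/negP; rewrite -ltNge.
    by rewrite -ltNge => ->.
  over.
apply: measurable_funM => //; apply: measurable_indic.
by apply: measurableD; exact: measurable_radial_ball.
Qed.

Lemma truncated_power_ge0 s r x : 0 <= truncated_power s r x.
Proof. by rewrite mulr_ge0 ?powR_ge0. Qed.

Lemma integral_truncated_power s t r : 0 < s + D -> 0 <= t -> t <= r ->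
  (\int[mu]_(x in [set x | (N x <= t)%R]) (truncated_power s r x)%:E =
   (B / (s + D) * t `^ (s + D))%:E)%E.
Proof.
move=> sD0 t0 tr.
rewrite -(integral_powR_ball mN N0 D0 (ltW B0) muN sD0 t0).
have mt := measurable_radial_ball t.
have m0 := measurable_radial_ball 0.
rewrite [LHS](ge0_negligible_integral m0)//; last 2 first.
- by apply/measurable_EFinP; apply: measurable_funTS; exact: measurable_truncated_power.
- by move=> x _; rewrite lee_fin truncated_power_ge0.
rewrite [RHS](ge0_negligible_integral m0)//; last 2 first.
- by apply/measurable_EFinP; apply: measurable_funTS.
- by move=> x _; rewrite lee_fin powR_ge0.
apply: eq_integral => x /set_mem/= [xt /negP]; rewrite -ltNge => x0.
by rewrite /truncated_power x0 (le_trans xt tr) mulr1.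
Qed.

(** Only the exponent of [r] and the positivity of the constant matter below.
    For [p = +oo] the supremum [r `^ s] is essential because the shells
    [t < N x <= r] have positive measure. *)
Lemma Lnorm_truncated_power (p : \bar R) s : (1 <= p)%E ->
  0 < s + D * fine p^-1%E ->
  exists2 c, 0 < c & forall r, 0 < r ->
    ('N[mu]_p[EFin \o truncated_power s r])%E =
    (c * r `^ (s + D * fine p^-1%E))%:E.
Proof.
case: p => [p| |//].
- rewrite lee_fin => p1; have p0 : 0 < p by exact: lt_le_trans p1.
  rewrite inver gt_eqF//= => sp0.
  have spE : s * p + D = (s + D * p^-1) * p by rewrite mulrDl mulfVK ?gt_eqF.
  have sp : 0 < s * p + D by rewrite spE mulr_gt0.
  exists ((B / (s * p + D)) `^ p^-1); first by apply: powR_gt0; exact: divr_gt0.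
  move=> r r0; rewrite Lnorm_EFin.
  have -> : (\int[mu]_x (`|truncated_power s r x| `^ p)%:E)%E =
      (\int[mu]_(x in [set x | (N x <= r)%R]) (truncated_power (s * p) r x)%:E)%E.
    rewrite [RHS]integral_mkcond; apply: eq_integral => x _.
    rewrite patchE ger0_norm ?truncated_power_ge0// /truncated_power.
    case: ifPn => [_|/negP xr].
      case: (0 < N x <= r); first by rewrite !mulr1 powRrM.
      by rewrite !mulr0 powR0 ?gt_eqF.
    case: andP => [[_ xr']|_]; first by exfalso; apply: xr; exact/mem_set.
    by rewrite mulr0 powR0 ?gt_eqF.
  rewrite (integral_truncated_power sp (ltW r0) (lexx r)) poweR_EFin.
  rewrite powRM ?divr_ge0 ?powR_ge0 ?ltW// -powRrM.
  by rewrite spE mulfK ?gt_eqF.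
- move=> _; rewrite invey/= mulr0 addr0 => s0.
  exists 1 => // r r0; rewrite mul1r unlock mu_setT_gt0.
  apply/eqP; rewrite eq_le; apply/andP; split.
    apply/ess_sup_inf.ess_supP; apply: nearW => x /=.
    rewrite lee_fin ger0_norm ?truncated_power_ge0// /truncated_power.
    case: andP => [[x0 xr]|_]; last by rewrite mulr0 powR_ge0.
    by rewrite mulr1 ge0_ler_powR// ?nnegrE ltW.
  rewrite leNgt; apply/negP; set E := ess_sup_inf.ess_sup _ _ => Er.
  have E0 : (0 <= E)%E.
    apply: ess_sup_inf.ess_sup_gee => //; apply: nearW => x /=.
    by rewrite lee_fin.
  have [y yE] : exists y, E = y%:E.
    by move: E0 Er; case: E => // y _ _; exists y.
  rewrite yE !lte_fin !lee_fin in E0 Er.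
  (* [t] is the radius at which the power takes the value [y]. *)
  pose t := y `^ s^-1.
  have tr : t < r.
    have := gt0_ltr_powR (_ : 0 < s^-1) E0 (powR_ge0 _ _) Er.
    by rewrite -powRrM mulfV ?gt_eqF// powRr1 ?ltW// invr_gt0; apply.
  have : mu ([set x | N x <= r] `\` [set x | N x <= t]) = 0%E.
    apply/negligibleP; first by apply: measurableD; exact: measurable_radial_ball.
    have := ess_sup_inf.ess_sup_ge mu (abse \o (EFin \o truncated_power s r)).
    apply: negligibleS => x /= [xr /negP]; rewrite -ltNge => tx.
    rewrite -/E yE lee_fin ger0_norm ?truncated_power_ge0//.
    rewrite /truncated_power xr andbT (le_lt_trans (powR_ge0 _ _) tx) mulr1.
    apply/negP; rewrite -ltNge.
    have := gt0_ltr_powR s0 (powR_ge0 _ _ : t \in Num.nneg) (N0 x) tx.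
    by rewrite /t -powRrM mulVf ?gt_eqF// powRr1.
  have rfin : (mu [set x | (N x <= r)%R] < +oo)%E by rewrite muN ?ltry// ltW.
  have -> : mu ([set x | N x <= r] `\` [set x | N x <= t]) =
      (mu [set x | (N x <= r)%R] - mu [set x | (N x <= t)%R])%E.
    rewrite measureD//; [|exact: measurable_radial_ball..].
    by rewrite setIidr// => x /= xt; exact: le_trans xt (ltW tr).
  rewrite !muN ?powR_ge0 ?(ltW r0)// => /eqP.
  rewrite -EFinB -mulrBr eqe mulf_eq0 gt_eqF ?divr_gt0//= subr_eq0.
  by rewrite gt_eqF// gt0_ltr_powR// nnegrE ?powR_ge0// ltW.
Qed.

End radial_hardy.

(** * Necessity of the conditions and the lower bound *)

Lemma powR_le_powR_all_eq (R : realType) (K L e f : R) : 0 < K ->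
  (forall r, 0 < r -> K * r `^ e <= L * r `^ f) -> e = f.
Proof.
move=> K0 KL; apply/eqP/negPn/negP; rewrite -subr_eq0 => ef.
have KLg r : 0 < r -> K * r `^ (e - f) <= L.
  move=> r0; rewrite powRB; last by rewrite [r == 0]gt_eqF ?implybT.
  by rewrite mulrA ler_pdivrMr ?powR_gt0// KL.
(* At this value of [r `^ (e - f)] the left-hand side is [`|L| + K > L]. *)
have M0 : 0 < `|L| / K + 1 by rewrite ltr_wpDl// divr_ge0// ltW.
have := KLg ((`|L| / K + 1) `^ (e - f)^-1) (powR_gt0 _ M0).
rewrite -powRrM mulVf// powRr1 ?(ltW M0)// mulrDr mulr1 mulrCA mulfV ?gt_eqF// mulr1.
by move=> /le_trans/(_ (ler_norm L)); rewrite leNgt ltrDl K0.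
Qed.

Section radial_hardy_operator.
Context d (T : measurableType d) (R : realType).
Variables (mu : {measure set T -> \bar R}) (N : T -> R) (B D : R).
Hypotheses (mN : measurable_fun setT N) (N0 : forall x, 0 <= N x).
Hypotheses (D0 : 0 < D) (B0 : 0 < B).
Hypothesis muN : forall r, 0 <= r ->
  mu [set x | N x <= r] = (B / D * r `^ D)%:E.

Definition radial_hardy (f : T -> R) (x : T) : R :=
  \int[mu]_(y in [set y | N y <= N x]) f y.

Lemma radial_hardy_truncated_power s r x : 0 < s + D -> N x <= r ->
  radial_hardy (truncated_power N s r) x = B / (s + D) * N x `^ (s + D).
Proof.
move=> sD xr; rewrite /radial_hardy /Rintegral.
by rewrite (integral_truncated_power mN N0 D0 B0 muN).
Qed.

Section necessity.
Variables (p : \bar R) (a b C : R).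
Hypothesis p1 : (1 <= p)%E.
Local Notation theta := (fine p^-1%E).
Hypothesis hardy : forall f : T -> R, measurable_fun setT f ->
  ('N[mu]_p[EFin \o (fun x => N x `^ b * f x)%R] < +oo)%E ->
  ('N[mu]_p[EFin \o (fun x => N x `^ (- a) * radial_hardy f x)%R] <=
   C%:E * 'N[mu]_p[EFin \o (fun x => N x `^ b * f x)%R])%E.

(** For [f = truncated_power N s r] the function [N `^ b * f] is again a truncated
    power, and [N `^ (- a) * H f] dominates one. *)
Let hardy_truncated_power s : 0 < s + D -> 0 < s + b + D * theta -> forall r, 0 < r ->
  ((B / (s + D))%:E * 'N[mu]_p[EFin \o truncated_power N (s + D - a) r] <=
   C%:E * 'N[mu]_p[EFin \o truncated_power N (s + b) r])%E.
Proof.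
move=> sD sb r r0.
have fE : (fun x => N x `^ b * truncated_power N s r x) = truncated_power N (s + b) r.
  apply/funext => x; rewrite /truncated_power mulrA.
  case: andP => [[x0 _]|_]; last by rewrite !mulr0.
  by rewrite [s + b]addrC powRD// [N x == 0]gt_eqF ?implybT.
have [c c0 cE] := Lnorm_truncated_power mN N0 D0 B0 muN p1 sb.
have := hardy (measurable_truncated_power mN s r).
rewrite fE cE// ltry => /(_ isT); apply: le_trans.
have BsD : 0 <= B / (s + D) by rewrite divr_ge0 ?ltW.
rewrite -LnormZl//; last exact: measurable_truncated_power.
apply: le_Lnorm => // x /=; rewrite lee_fin.
rewrite ger0_norm; last by rewrite mulr_ge0 ?truncated_power_ge0.
rewrite /truncated_power; case: (boolP (0 < N x <= r)) => [/andP[x0 xr]|_]; last first.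
  by rewrite !mulr0.
rewrite radial_hardy_truncated_power// mulr1 mulrCA -powRD; last first.
  by rewrite [N x == 0]gt_eqF ?implybT.
by rewrite [- a + _]addrC ger0_norm// mulr_ge0 ?powR_ge0.
Qed.

(** Letting [r] vary determines [a + b]; letting [s] vary then bounds [C] from
    below by [B / u] for every [u] above [Num.max kap 0]. Since [C] is finite this
    maximum is at least [B / C], so it is positive and equals [kap]. *)
Lemma hardy_necessary :
  [/\ b * theta < a * (1 - theta), a + b = D &
      B / (a * (1 - theta) - b * theta) <= C].
Proof.
have theta0 : 0 <= theta by rewrite fine_ge0// inve_ge0 (le_trans _ p1).
have abD : a + b = D.
  (* Any large enough exponent makes all the norms finite. *)
  have [s [s0 as_ bs]] : exists s : R, [/\ 0 <= s, a <= s & - b < s].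
    exists (Num.max 0 (Num.max a (1 - b))).
    by rewrite lt_max !le_max !lexx lt_max ltrDr ltr01 !orbT.
  have Dt : 0 <= D * theta by rewrite mulr_ge0 ?(ltW D0).
  have Dp : 0 < D by [].
  have sD : 0 < s + D by lra.
  have sb : 0 < s + b + D * theta by lra.
  have sa : 0 < s + D - a + D * theta by lra.
  have [c c0 cE] := Lnorm_truncated_power mN N0 D0 B0 muN p1 sb.
  have [e e0 eE] := Lnorm_truncated_power mN N0 D0 B0 muN p1 sa.
  have : s + D - a + D * theta = s + b + D * theta.
    apply: (@powR_le_powR_all_eq _ (B / (s + D) * e) (C * c)).
      by rewrite mulr_gt0// divr_gt0.
    move=> r r0; have := hardy_truncated_power sD sb r0.
    by rewrite cE// eE// -!EFinM lee_fin !mulrA.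
  lra.
pose kap := a * (1 - theta) - b * theta.
have BuC u : 0 < u -> kap < u -> B / u <= C.
  move=> u0 ku; have sD : 0 < (u - D) + D by rewrite subrK.
  have sb : 0 < (u - D) + b + D * theta by rewrite -abD; move: ku; rewrite /kap; lra.
  have [c c0 cE] := Lnorm_truncated_power mN N0 D0 B0 muN p1 sb.
  have := hardy_truncated_power sD sb ltr01.
  rewrite (_ : u - D + D - a = u - D + b); last by rewrite -abD; lra.
  rewrite cE// -!EFinM lee_fin ler_pM2r ?subrK//.
  by rewrite powR1 mulr1.
have C0 : 0 < C.
  apply: lt_le_trans (BuC (`|kap| + 1) _ _); first by rewrite divr_gt0// ltr_wpDl.
    by rewrite ltr_wpDl.
  by rewrite (le_lt_trans (ler_norm _))// ltrDl.
have BCk : B / C <= Num.max kap 0.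
  apply/ler_addgt0Pr => e e0.
  have u0 : 0 < Num.max kap 0 + e by rewrite ltr_wpDl// le_max lexx orbT.
  have ku : kap < Num.max kap 0 + e.
    by apply: (@le_lt_trans _ _ (Num.max kap 0)); rewrite ?ltrDl// le_max lexx.
  by rewrite ler_pdivrMr// mulrC -ler_pdivrMr// BuC.
have kap0 : 0 < kap.
  have := lt_le_trans (divr_gt0 B0 C0) BCk.
  by rewrite lt_max ltxx orbF.
split => //; first by rewrite -subr_gt0.
rewrite -/kap ler_pdivrMr// mulrC -ler_pdivrMr//.
by move: BCk; rewrite (max_idPl _)// ltW.
Qed.

End necessity.

End radial_hardy_operator.

(** * Sufficiency of the conditions *)

Lemma poweR_le_of_root (R : realType) (J K : \bar R) (c p q : R) :
  0 < p -> (0 <= J)%E -> (0 <= K)%E -> 0 <= c -> q^-1 * p = p - 1 ->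
  (J <= K `^ p^-1 * (c `^ q^-1)%:E)%E -> (J `^ p <= (c `^ (p - 1))%:E * K)%E.
Proof.
move=> p0 J0 K0 c0 qp JK.
have M0 : (0 <= K `^ p^-1 * (c `^ q^-1)%:E)%E.
  by rewrite mule_ge0 ?poweR_ge0// lee_fin powR_ge0.
have -> : ((c `^ (p - 1))%:E * K = (K `^ p^-1 * (c `^ q^-1)%:E) `^ p)%E.
  rewrite poweRM ?poweR_ge0 ?lee_fin ?powR_ge0// -poweRrM mulVf ?gt_eqF//.
  by rewrite poweRe1// muleC poweR_EFin -powRrM qp.
apply: gt0_ler_poweR JK; [exact: ltW|..].
- by rewrite in_itv/= leey andbT.
- by rewrite in_itv/= leey andbT.
Qed.

Section sufficiency.
Context d (T : measurableType d) (R : realType).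
Variables (mu : {measure set T -> \bar R}) (N : T -> R) (B D : R).
Hypotheses (mN : measurable_fun setT N) (N0 : forall x, 0 <= N x).
Hypotheses (D0 : 0 < D) (B0 : 0 < B).
Hypothesis muN : forall r, 0 <= r ->
  mu [set x | N x <= r] = (B / D * r `^ D)%:E.

(** Hoelder's inequality for [|g| = (N `^ gam |g|) * N `^ (- gam)] on a ball. The
    relation between [gam] and [kap] makes the integral of [N `^ (- gam * p')]
    over the ball equal to [B / kap * r `^ kap]. For [p = 1] it forces [gam = 0]
    and both sides agree. *)
Lemma hoelder_radial_ball (p kap gam r : R) (g : T -> R) :
  1 <= p -> 0 < kap -> gam * p = (p - 1) * (D - kap) -> 0 <= r ->
  measurable_fun setT g -> (forall y, N y = 0 -> g y = 0) ->
  ((\int[mu]_(y in [set y | (N y <= r)%R]) `|g y|%:E) `^ p <=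
   ((B / kap * r `^ kap) `^ (p - 1))%:E *
   \int[mu]_(y in [set y | (N y <= r)%R]) ((N y `^ gam * `|g y|) `^ p)%:E)%E.
Proof.
move=> p1 kap0 gamE r0 mg g0.
have p0 : 0 < p by exact: lt_le_trans p1.
move: p1; rewrite le_eqVlt => /predU1P[p1|p1].
  rewrite -p1 subrr powRr0 mul1e poweRe1; last exact: integral_ge0.
  have -> : gam = 0 by move: gamE; rewrite -p1 subrr mul0r mulr1.
  rewrite le_eqVlt; apply/orP; left; apply/eqP; apply: eq_integral => y _.
  by rewrite powRr0 mul1r powRr1.
have mball := measurable_radial_ball mN r.
have [q qE] : exists q, q = p / (p - 1) by eexists.
have p10 : 0 < p - 1 by rewrite subr_gt0.
have q0 : 0 < q by rewrite qE divr_gt0.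
have pq : p^-1 + q^-1 = 1.
  by rewrite qE invf_div -[X in X + _]mul1r -mulrDl addrC subrK divff ?gt_eqF.
pose I (y : T) : R := \1_[set y | N y <= r] y.
have mI : measurable_fun setT I by exact: measurable_indic.
have mpow s : measurable_fun setT (fun y => N y `^ s).
  exact: (measurableT_comp (measurable_powR s) mN).
pose u y := N y `^ gam * `|g y| * I y.
pose v y := N y `^ (- gam) * I y.
have mu_ : measurable_fun setT u.
  by apply: measurable_funM => //; apply: measurable_funM => //; exact: measurableT_comp.
have mv : measurable_fun setT v by exact: measurable_funM.
have := hoelder mu mu_ mv p0 q0 pq.
have restrict (h k : T -> R) : (forall y, k y = h y * I y) ->
    (\int[mu]_(y in [set y | (N y <= r)%R]) (h y)%:E = \int[mu]_y (k y)%:E)%E.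
  move=> hk; rewrite integral_mkcond; apply: eq_integral => y _.
  by rewrite patchE hk /I indicE; case: ifP => _; rewrite ?mulr1 ?mulr0.
have uv : ('N[mu]_1[(EFin \o (u \* v))%R] =
    \int[mu]_(y in [set y | (N y <= r)%R]) `|g y|%:E)%E.
  rewrite Lnorm1 (restrict _ (fun y => `|u y * v y|))// => y.
  have [y0|y0] := eqVneq (N y) 0.
    by rewrite /u g0// normr0 !(mulr0, mul0r) normr0.
  rewrite ger0_norm; last by rewrite !mulr_ge0 ?powR_ge0// /I.
  rewrite /u /v powRN mulrACA; congr (_ * _).
    by rewrite mulrAC mulfV ?mul1r// powR_eq0 (negbTE y0).
  by rewrite /I indicE; case: (_ \in _); rewrite ?mulr1 ?mulr0.
have up : (\int[mu]_y (`|u y| `^ p)%:E =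
    \int[mu]_(y in [set y | (N y <= r)%R]) ((N y `^ gam * `|g y|) `^ p)%:E)%E.
  rewrite (restrict _ (fun y => `|u y| `^ p))// => y.
  rewrite ger0_norm; last by rewrite !mulr_ge0 ?powR_ge0// /I.
  rewrite /u /I indicE; case: (_ \in _); first by rewrite !mulr1.
  by rewrite !mulr0 powR0 ?gt_eqF.
have vq : (\int[mu]_y (`|v y| `^ q)%:E = (B / kap * r `^ kap)%:E)%E.
  have kE : - gam * q + D = kap.
    by rewrite mulNr qE mulrA gamE mulrAC divff ?mul1r ?opprB ?subrK ?lt0r_neq0.
  have kE0 : 0 < - gam * q + D by rewrite kE.
  rewrite -[in RHS]kE -(integral_powR_ball mN N0 D0 (ltW B0) muN kE0 r0).
  symmetry; apply: restrict => y.
  rewrite ger0_norm; last by rewrite !mulr_ge0 ?powR_ge0// /I.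
  rewrite /v /I indicE; case: (_ \in _); first by rewrite !mulr1 powRrM.
  by rewrite !mulr0 powR0 ?gt_eqF.
rewrite uv !Lnorm_EFin up vq poweR_EFin => uvle.
apply: poweR_le_of_root uvle.
- exact: p0.
- exact: integral_ge0.
- by apply: integral_ge0 => y _; rewrite lee_fin powR_ge0.
- exact: mulr_ge0 (divr_ge0 (ltW B0) (ltW kap0)) (powR_ge0 _ _).
- by rewrite qE invf_div mulfVK ?gt_eqF.
Qed.

Let mu_sigma_finite : sigma_finite setT mu.
Proof.
exists (fun n => [set x | N x <= n%:R]).
  apply/seteqP; split => // x _; exists (Num.truncn (N x)).+1 => //=.
  by rewrite ltW// truncnS_gt.
move=> n; split; first exact: measurable_radial_ball.
by rewrite muN// ltry.
Qed.

(** Tonelli's theorem for the triangle [N y <= N x]: the inner integral of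
    [N x `^ (- kap - D)] over [N x >= N y] is [B / kap * N y `^ (- kap)]. *)
Lemma integral_powR_mul_ball (kap : R) (G : T -> R) : 0 < kap ->
  measurable_fun setT G -> (forall y, 0 <= G y) -> (forall y, N y = 0 -> G y = 0) ->
  (\int[mu]_x ((N x `^ (- kap - D))%:E *
     \int[mu]_(y in [set y | (N y <= N x)%R]) (G y)%:E) =
   (B / kap)%:E * \int[mu]_y (G y * N y `^ (- kap))%:E)%E.
Proof.
move=> kap0 mG G0 GN0.
pose S : set (T * T) := [set z | N z.2 <= N z.1].
have mS : measurable S.
  have mf : measurable_fun setT (fun z : T * T => N z.1 - N z.2).
    by apply: measurable_funB; [exact: (measurableT_comp mN measurable_fst)
      |exact: (measurableT_comp mN measurable_snd)].
  rewrite (_ : S = setT `&` (fun z => N z.1 - N z.2) @^-1` `[0, +oo[%classic).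
    exact: mf.
  by rewrite setTI; apply/seteqP; split => z; rewrite /S /= in_itv/= andbT subr_ge0.
have mpow s : measurable_fun setT (fun y => N y `^ s).
  exact: (measurableT_comp (measurable_powR s) mN).
pose F (z : T * T) : \bar R := (N z.1 `^ (- kap - D) * (G z.2 * \1_S z))%:E.
have mF : measurable_fun setT F.
  apply/measurable_EFinP; apply: measurable_funM.
    exact: (measurableT_comp (mpow _) measurable_fst).
  apply: measurable_funM; last exact: measurable_indic.
  exact: (measurableT_comp mG measurable_snd).
have F0 z : (0 <= F z)%E by rewrite lee_fin !mulr_ge0 ?powR_ge0.
have FE1 x : (\int[mu]_y F (x, y) = (N x `^ (- kap - D))%:E *
     \int[mu]_(y in [set y | (N y <= N x)%R]) (G y)%:E)%E.
  rewrite -ge0_integralZl//; last 4 first.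
  - exact: measurable_radial_ball.
  - by apply/measurable_EFinP; exact: measurable_funTS.
  - by move=> y _; rewrite lee_fin.
  - by rewrite lee_fin powR_ge0.
  rewrite [RHS]integral_mkcond; apply: eq_integral => y _.
  rewrite patchE /F /= indicE.
  suff -> : ((x, y) \in S) = (y \in [set y | N y <= N x]).
    by case: (_ \in _); rewrite ?mulr1 ?mulr0.
  by apply/idP/idP => /set_mem h; apply/mem_set; exact: h.
have FE2 y : (\int[mu]_x F (x, y) = (B / kap)%:E * (G y * N y `^ (- kap))%:E)%E.
  have [y0|y0] := eqVneq (N y) 0.
    rewrite GN0// mul0r mule0 integral0_eq// => x _.
    by rewrite /F /= GN0// mul0r mulr0.
  have Ny : 0 < N y by rewrite lt_neqAle eq_sym y0 N0.
  have sD : (- kap - D) + D < 0 by rewrite subrK oppr_lt0.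
  have -> : ((B / kap)%:E * (G y * N y `^ (- kap))%:E = (G y)%:E *
      \int[mu]_(x in [set x | (N y <= N x)%R]) (N x `^ (- kap - D))%:E)%E.
    rewrite (integral_powR_coball mN N0 D0 (ltW B0) muN sD Ny).
    by rewrite -!EFinM subrK opprK mulrCA.
  have mco : measurable [set x | N y <= N x].
    rewrite (_ : [set x | _] = setT `&` N @^-1` `[N y, +oo[%classic); first exact: mN.
    by rewrite setTI; apply/seteqP; split => x /=; rewrite in_itv/= andbT.
  rewrite -ge0_integralZl//; last 3 first.
  - by apply/measurable_EFinP; exact: measurable_funTS.
  - by move=> x _; rewrite lee_fin powR_ge0.
  - by rewrite lee_fin.
  rewrite [RHS]integral_mkcond; apply: eq_integral => x _.
  rewrite patchE /F /= indicE.
  suff -> : ((x, y) \in S) = (x \in [set x | N y <= N x]).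
    by case: (_ \in _); rewrite ?mulr1 ?mulr0// mulrC.
  by apply/idP/idP => /set_mem h; apply/mem_set; exact: h.
transitivity (\int[mu]_x \int[mu]_y F (x, y))%E.
  by apply: eq_integral => x _; rewrite FE1.
transitivity (\int[mu]_y \int[mu]_x F (x, y))%E.
  have [nu nuE] := sigma_finite_measure_exists mu_sigma_finite.
  have intE (h : T -> \bar R) : (\int[mu]_x h x = \int[nu]_x h x)%E.
    by apply: eq_measure_integral => A _ _; rewrite nuE.
  rewrite !intE; under eq_integral do rewrite intE.
  under [RHS]eq_integral do rewrite intE.
  exact: (@fubini_tonelli _ _ _ _ _ nu nu F mF F0).
under eq_integral do rewrite FE2.
rewrite ge0_integralZl//.
- by apply/measurable_EFinP; exact: measurable_funM.
- by move=> y _; rewrite lee_fin mulr_ge0 ?powR_ge0.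
- by rewrite lee_fin divr_ge0 ?(ltW B0) ?(ltW kap0).
Qed.

Let measurable_off_origin : measurable_fun setT (fun y => (N y != 0)%R%:R : R).
Proof.
rewrite (_ : (fun _ => _) = \1_(~` [set x | N x <= 0])); last first.
  apply/funext => y; rewrite indicE; congr (nat_of_bool _)%:R.
  apply/idP/idP => [y0|/set_mem/= /negP].
    by apply/mem_set => /= y0'; move/negP: y0; apply; rewrite eq_le y0' N0.
  by rewrite eq_le N0 andbT.
by apply: measurable_indic; apply: measurableC; exact: measurable_radial_ball.
Qed.

(** The origin is negligible, so [f] may be replaced by a function vanishing there;
    the exponent rules for [N] then hold wherever the function is not zero. *)
Let integral_ball_origin (f : T -> R) r : measurable_fun setT f ->
  (\int[mu]_(y in [set y | (N y <= r)%R]) `|f y|%:E =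
   \int[mu]_(y in [set y | (N y <= r)%R]) `|f y * (N y != 0)%R%:R|%:E)%E.
Proof.
move=> mf.
have m0 := measurable_radial_ball mN 0.
have mr := measurable_radial_ball mN r.
have mu0 : mu [set x | N x <= 0] = 0%E by rewrite muN// powR0 ?mulr0// gt_eqF.
rewrite [LHS](ge0_negligible_integral m0 mr _ _ mu0); last 2 first.
- by apply/measurable_EFinP; apply: measurable_funTS; exact: measurableT_comp.
- by move=> y _; rewrite lee_fin.
rewrite [RHS](ge0_negligible_integral m0 mr _ _ mu0); last 2 first.
- apply/measurable_EFinP; apply: measurable_funTS; apply: measurableT_comp => //.
  exact: measurable_funM.
- by move=> y _; rewrite lee_fin.
apply: eq_integral => y /set_mem/= [_ y0]; rewrite (_ : N y != 0) ?mulr1//.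
by apply/eqP => y0'; apply: y0; rewrite y0'.
Qed.

Let normr_radial_hardy (f : T -> R) x :
  mu.-integrable [set y | N y <= N x] (EFin \o f) ->
  (`|radial_hardy mu N f x|%:E <= \int[mu]_(y in [set y | (N y <= N x)%R]) `|f y|%:E)%E.
Proof.
move=> intf.
rewrite /radial_hardy /Rintegral -abse_EFin fineK; last first.
  by apply: integrable_fin_num => //; exact: measurable_radial_ball.
apply: le_abse_integral; first exact: measurable_radial_ball.
by have /integrableP[] := intf.
Qed.

(** Schur's test: [hoelder_radial_ball] bounds [`|H f| `^ p] at [x] by
    [(B / kap * N x `^ kap) `^ (p - 1)] times an integral over the ball. The
    powers of [N x] combine to [N x `^ (- kap - D)], and exchanging the integrals
    by [integral_powR_mul_ball] leaves the norm of [N `^ b * f] with the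
    constant [(B / kap) `^ p]. *)
Lemma hardy_sufficient_real (p a b : R) (f : T -> R) : 1 <= p ->
  a + b = D -> b * p^-1 < a * (1 - p^-1) -> measurable_fun setT f ->
  ('N[mu]_p%:E[EFin \o (fun x => N x `^ b * f x)%R] < +oo)%E ->
  (forall x, mu.-integrable [set y | N y <= N x] (EFin \o f)) /\
  ('N[mu]_p%:E[EFin \o (fun x => N x `^ (- a) * radial_hardy mu N f x)%R] <=
   (B / (a * (1 - p^-1) - b * p^-1))%:E *
   'N[mu]_p%:E[EFin \o (fun x => N x `^ b * f x)%R])%E.
Proof.
move=> p1 abD; rewrite -subr_gt0; set kap := (_ - _) => kap0 mf fin.
have p0 : 0 < p by exact: lt_le_trans p1.
have kapE : kap * p = a * (p - 1) - b.
  by rewrite /kap mulrBl mulfVK ?gt_eqF// -mulrA mulrBl mul1r mulVf ?gt_eqF.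
pose gam := b + kap / p.
have gamE : gam * p = (p - 1) * (D - kap).
  rewrite /gam mulrDl mulfVK ?gt_eqF// -abD.
  by move: kapE => /eqP; rewrite -subr_eq0 => /eqP kapE; lra.
pose g y := f y * (N y != 0)%R%:R.
have gN0 y : N y = 0 -> g y = 0 by rewrite /g => ->; rewrite eqxx mulr0.
have mg : measurable_fun setT g by exact: measurable_funM.
have mpow s : measurable_fun setT (fun y => N y `^ s).
  exact: (measurableT_comp (measurable_powR s) mN).
pose w y := `|N y `^ b * f y| `^ p.
have mw : measurable_fun setT w.
  apply: (measurableT_comp (measurable_powR p)); apply: measurableT_comp => //.
  exact: measurable_funM.
have w0 y : 0 <= w y by exact: powR_ge0.
pose G y := (N y `^ gam * `|g y|) `^ p.
have mG : measurable_fun setT G.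
  apply: (measurableT_comp (measurable_powR p)); apply: measurable_funM => //.
  exact: measurableT_comp.
have G0 y : 0 <= G y by exact: powR_ge0.
have GN0 y : N y = 0 -> G y = 0.
  by move=> /gN0; rewrite /G => ->; rewrite normr0 mulr0 powR0 ?gt_eqF.
have GE y : N y != 0 -> G y = N y `^ kap * w y.
  move=> y0; rewrite /G /g y0 mulr1 /w normrM (ger0_norm (powR_ge0 _ _)).
  rewrite !powRM ?powR_ge0// -!powRrM mulrA -powRD ?y0 ?implybT//.
  congr (_ `^ _ * _); rewrite gamE -abD.
  by move: kapE => /eqP; rewrite -subr_eq0 => /eqP kapE; lra.
have Gw y : G y <= N y `^ kap * w y.
  have [/GN0 ->|/GE ->//] := eqVneq (N y) 0.
  by rewrite mulr_ge0 ?powR_ge0.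
have Gkw y : G y * N y `^ (- kap) <= w y.
  have [/GN0 ->|y0] := eqVneq (N y) 0; first by rewrite mul0r.
  rewrite GE// mulrC mulrA -powRD ?y0 ?implybT//.
  by rewrite addNr powRr0 mul1r.
pose W : \bar R := (\int[mu]_y (w y)%:E)%E.
pose J x : \bar R := (\int[mu]_(y in [set y | (N y <= N x)%R]) `|f y|%:E)%E.
have W0 : (0 <= W)%E by apply: integral_ge0 => y _; rewrite lee_fin.
have J0 x : (0 <= J x)%E by apply: integral_ge0.
have Wfin : (W < +oo)%E.
  by move: fin; rewrite Lnorm_EFin; apply: lty_poweRy; rewrite invr_eq0 gt_eqF.
have JG x : (J x `^ p <= ((B / kap * N x `^ kap) `^ (p - 1))%:E *
    \int[mu]_(y in [set y | (N y <= N x)%R]) (G y)%:E)%E.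
  rewrite /J integral_ball_origin//.
  exact: (hoelder_radial_ball p1 kap0 gamE (N0 x) mg gN0).
have GW x : (\int[mu]_(y in [set y | (N y <= N x)%R]) (G y)%:E <=
    (N x `^ kap)%:E * W)%E.
  rewrite integral_mkcond -ge0_integralZl//; last 3 first.
  - exact/measurable_EFinP.
  - by move=> y _; rewrite lee_fin.
  - by rewrite lee_fin powR_ge0.
  apply: ge0_le_integralT => y; first by apply: erestrict_ge0 => z _; rewrite lee_fin.
  rewrite patchE; case: ifPn => [/set_mem/= yx|_]; last first.
    by rewrite mule_ge0// lee_fin ?powR_ge0.
  rewrite -EFinM lee_fin; apply: le_trans (Gw y) _; apply: ler_wpM2r => //.
  by apply: ge0_ler_powR; rewrite ?nnegrE// ltW.
have Jfin x : (J x < +oo)%E.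
  apply: (@lty_poweRy _ _ p); first by rewrite gt_eqF.
  apply: le_lt_trans (JG x) _; apply: lte_mul_pinfty.
  - by rewrite lee_fin powR_ge0.
  - by [].
  - apply: le_lt_trans (GW x) _; apply: lte_mul_pinfty => //.
    by rewrite lee_fin powR_ge0.
have intf x : mu.-integrable [set y | N y <= N x] (EFin \o f).
  apply/integrableP; split; last exact: Jfin.
  by apply/measurable_EFinP; exact: measurable_funTS.
split => //.
(* [K] goes inside the inner integral, so that the Tonelli step applies to
   [K * G] as it stands. *)
pose K := (B / kap) `^ (p - 1).
have K0 : 0 <= K by exact: powR_ge0.
have pointwise x : ((`|N x `^ (- a) * radial_hardy mu N f x| `^ p)%:E <=
    (N x `^ (- kap - D))%:E *
    \int[mu]_(y in [set y | (N y <= N x)%R]) (K * G y)%:E)%E.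
  rewrite normrM (ger0_norm (powR_ge0 _ _)) powRM ?powR_ge0// -powRrM EFinM.
  have HJ := normr_radial_hardy (intf x).
  have [x0|x0] := eqVneq (N x) 0.
    have : J x = 0%E.
      rewrite /J integral_ball_origin// integral0_eq// => y /=; rewrite x0 => y0.
      have -> : N y = 0 by apply/eqP; rewrite eq_le y0 N0.
      by rewrite eqxx mulr0 normr0.
    move=> Jx; move: HJ; rewrite -/(J x) Jx lee_fin normr_le0 => /eqP ->.
    rewrite normr0 powR0 ?gt_eqF// mule0 mule_ge0// ?lee_fin ?powR_ge0//.
    by apply: integral_ge0 => y _; rewrite lee_fin mulr_ge0.
  have -> : (\int[mu]_(y in [set y | (N y <= N x)%R]) (K * G y)%:E =
      K%:E * \int[mu]_(y in [set y | (N y <= N x)%R]) (G y)%:E)%E.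
    rewrite -ge0_integralZl//; first exact: measurable_radial_ball.
    - by apply/measurable_EFinP; exact: measurable_funTS.
    - by move=> y _; rewrite lee_fin.
  have powE : N x `^ (- a * p) * (B / kap * N x `^ kap) `^ (p - 1) =
      N x `^ (- kap - D) * K.
    rewrite powRM ?powR_ge0 ?divr_ge0 ?(ltW B0) ?(ltW kap0)// -/K -powRrM.
    rewrite mulrCA -powRD ?x0 ?implybT// mulrC; congr (_ `^ _ * _).
    rewrite -abD.
    by move: kapE => /eqP; rewrite -subr_eq0 => /eqP kapE; lra.
  rewrite [leRHS]muleA -[in leRHS]EFinM -powE [in leRHS]EFinM -[leRHS]muleA.
  apply: lee_wpmul2l.
    by rewrite lee_fin powR_ge0.
  apply: le_trans (JG x); rewrite -poweR_EFin; apply: gt0_ler_poweR HJ.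
  - exact: ltW.
  - by rewrite in_itv/= leey andbT lee_fin.
  - by rewrite in_itv/= leey andbT J0.
have main : (\int[mu]_x (`|N x `^ (- a) * radial_hardy mu N f x| `^ p)%:E <=
    ((B / kap) `^ p)%:E * W)%E.
  apply: (@le_trans _ _ (\int[mu]_x ((N x `^ (- kap - D))%:E *
     \int[mu]_(y in [set y | (N y <= N x)%R]) (K * G y)%:E))%E).
    by apply: ge0_le_integralT => x; [rewrite lee_fin powR_ge0|exact: pointwise].
  rewrite (integral_powR_mul_ball kap0); last 3 first.
  - exact: measurable_funM.
  - by move=> y; rewrite mulr_ge0.
  - by move=> y /GN0 ->; rewrite mulr0.
  have -> : (B / kap) `^ p = B / kap * K.
    by rewrite /K mulr_powRB1// divr_ge0 ?(ltW B0) ?(ltW kap0).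
  rewrite [in leRHS]EFinM -[leRHS]muleA; apply: lee_wpmul2l.
    by rewrite lee_fin divr_ge0 ?(ltW B0) ?(ltW kap0).
  rewrite /W -ge0_integralZl//; last 2 first.
  - exact/measurable_EFinP.
  - by move=> y _; rewrite lee_fin.
  apply: ge0_le_integralT => y.
    by rewrite lee_fin !mulr_ge0 ?powR_ge0.
  by rewrite -EFinM lee_fin -mulrA ler_wpM2l.
rewrite !Lnorm_EFin.
have -> : ((B / kap)%:E = (((B / kap) `^ p)%:E `^ p^-1))%E.
  by rewrite poweR_EFin -powRrM mulfV ?gt_eqF// powRr1 ?divr_ge0 ?(ltW B0) ?(ltW kap0).
rewrite -poweRM ?lee_fin ?powR_ge0//; apply: gt0_ler_poweR main.
- by rewrite invr_ge0 ltW.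
- rewrite in_itv/= leey andbT; apply: integral_ge0 => x _.
  by rewrite lee_fin powR_ge0.
- by rewrite in_itv/= leey andbT mule_ge0// lee_fin powR_ge0.
Qed.

Lemma hardy_sufficient_infty (a b : R) (f : T -> R) :
  a + b = D -> 0 < a -> measurable_fun setT f ->
  ('N[mu]_+oo[EFin \o (fun x => N x `^ b * f x)%R] < +oo)%E ->
  (forall x, mu.-integrable [set y | N y <= N x] (EFin \o f)) /\
  ('N[mu]_+oo[EFin \o (fun x => N x `^ (- a) * radial_hardy mu N f x)%R] <=
   (B / a)%:E * 'N[mu]_+oo[EFin \o (fun x => N x `^ b * f x)%R])%E.
Proof.
move=> abD a0 mf.
have := Lnorm_ge0 mu +oo (EFin \o (fun x => N x `^ b * f x)).
rewrite unlock; case: ifPn => [mu0|mu0]; last first.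
  have mu0' : mu setT = 0%E by apply/eqP; rewrite eq_le measure_ge0 leNgt mu0.
  exfalso; have := muN ler01; rewrite powR1 mulr1 => H.
  have : (mu [set x | (N x <= 1)%R] <= mu setT)%E.
    by apply: le_measure; rewrite ?inE//; exact: measurable_radial_ball.
  by rewrite mu0' H lee_fin leNgt divr_gt0.
have := ess_sup_inf.ess_sup_ge mu (abse \o (EFin \o (fun x => N x `^ b * f x))).
case: (ess_sup_inf.ess_sup _ _) => [M| |]//; rewrite /= lee_fin => fM M0 _.
pose g y := f y * (N y != 0)%R%:R.
have mg : measurable_fun setT g by exact: measurable_funM.
have ball_bound x : (\int[mu]_(y in [set y | (N y <= N x)%R]) `|f y|%:E <=
    (M * (B / a * N x `^ a))%:E)%E.
  have bD : 0 < - b + D by rewrite -abD addrCA addNr addr0.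
  have mball := measurable_radial_ball mN (N x).
  rewrite integral_ball_origin//.
  have aE : a = - b + D by rewrite -abD addrCA addNr addr0.
  rewrite EFinM {1 2}aE -(integral_powR_ball mN N0 D0 (ltW B0) muN bD (N0 x)).
  have mp : measurable_fun setT (fun y => N y `^ (- b)).
    exact: (measurableT_comp (measurable_powR (- b)) mN).
  rewrite -ge0_integralZl//; last 2 first.
  - by apply/measurable_EFinP; exact: measurable_funTS.
  - by move=> y _; rewrite lee_fin powR_ge0.
  apply: ae_ge0_le_integral => //.
  - by apply/measurable_EFinP; apply: measurable_funTS; exact: measurableT_comp.
  - by move=> y _; rewrite -EFinM lee_fin mulr_ge0 ?powR_ge0.
  - by apply/measurable_EFinP; apply: measurable_funTS; exact: measurable_funM.
  - apply: filterS fM => y; rewrite lee_fin => fM _; rewrite -EFinM lee_fin.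
    have [y0|y0] := eqVneq (N y) 0; first by rewrite mulr0 normr0 mulr_ge0 ?powR_ge0.
    rewrite mulr1 powRN ler_pdivlMr; last by rewrite powR_gt0// lt_neqAle eq_sym y0 N0.
    by move: fM; rewrite normrM (ger0_norm (powR_ge0 _ _)) mulrC.
have intf x : mu.-integrable [set y | N y <= N x] (EFin \o f).
  apply/integrableP; split; last exact: le_lt_trans (ball_bound x) (ltry _).
  by apply/measurable_EFinP; exact: measurable_funTS.
split => //; apply/ess_sup_inf.ess_supP; apply: nearW => x /=.
have HM : `|radial_hardy mu N f x| <= M * (B / a * N x `^ a).
  by rewrite -lee_fin; exact: le_trans (normr_radial_hardy (intf x)) (ball_bound x).
rewrite -EFinM lee_fin normrM (ger0_norm (powR_ge0 _ _)).
have Ba0 : 0 <= B / a by rewrite divr_ge0 ?(ltW B0) ?(ltW a0).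
have [x0|x0] := eqVneq (N x) 0.
  by rewrite x0 powR0 ?oppr_eq0 ?gt_eqF// mul0r mulr_ge0.
apply: le_trans (ler_wpM2l (powR_ge0 _ _) HM) _.
rewrite powRN mulrCA [B / a * _]mulrC mulKf ?powR_eq0 ?(negbTE x0)//.
by rewrite mulrC.
Qed.

End sufficiency.

(** * Dilations and cubes for Lebesgue measure *)

Section lebesgue_dilation.
Context {R : realType}.
Local Notation leb := (@lebesgue_measure R).

Lemma ge0_integral_dilation (t : R) (g : R -> \bar R) : 0 < t ->
  measurable_fun setT g -> (forall x, 0 <= g x)%E ->
  (\int[leb]_x g x = t%:E * \int[leb]_x g (t * x)%R)%E.
Proof.
move=> t0 mg g0.
have mt : measurable_fun setT (fun x : measurableTypeR R => (t * x : measurableTypeR R)).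
  exact: measurable_funM.
have [nu [nuE nuI]] := image_measure_exists leb mt.
rewrite -nuI//.
have lebE (u v : R) : leb `]u, v]%classic = (if u < v then (v - u)%:E else 0%E).
  by rewrite lebesgue_measure_itv/= lte_fin.
have nu_leb : forall A : set (measurableTypeR R), measurable A ->
    leb A = mscale (NngNum (ltW t0)) nu A.
  apply: lebesgue_measure_unique => _ [[a b] _ <-] /=.
  transitivity (t%:E * (if (a < b)%R then (t^-1 * (b - a))%:E else 0))%E.
    rewrite lebE; case: ifP => _; last by rewrite mule0.
    by rewrite -EFinM mulrA divff ?mul1r// gt_eqF.
  rewrite /mscale/= nuE; congr (_ * _)%E.
  transitivity (leb `](t^-1 * a : R), t^-1 * b]%classic).
    by rewrite lebE ltr_pM2l ?invr_gt0// mulrBr.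
  congr (leb _); apply/seteqP; split => x /=; rewrite !in_itv/=.
    by rewrite ltr_pdivrMl// ler_pdivlMl.
  by rewrite ltr_pdivrMl// ler_pdivlMl.
rewrite -(ge0_integral_mscale _ _ (NngNum (ltW t0)))//.
by apply: eq_measure_integral => A mA _; exact: nu_leb.
Qed.

End lebesgue_dilation.

Section borel_rV.
Context {R : realType}.
Local Notation leb := (@lebesgue_measure R).

Definition rV_cons m (z : R * 'rV[R]_m) : 'rV[R]_m.+1 :=
  row_mx (z.1%:M : 'M[R]_1) z.2.

Lemma rV_cons0 m (z : R * 'rV[R]_m) : rV_cons z ord0 ord0 = z.1.
Proof.
transitivity (row_mx (z.1%:M : 'M[R]_1) z.2 ord0 (lshift m ord0)).
  by congr (fun_of_matrix _ _ _); exact: val_inj.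
by rewrite row_mxEl mxE eqxx.
Qed.

Lemma rV_consS m (z : R * 'rV[R]_m) i : rV_cons z ord0 (lift ord0 i) = z.2 ord0 i.
Proof.
transitivity (row_mx (z.1%:M : 'M[R]_1) z.2 ord0 (rshift 1 i)).
  by congr (fun_of_matrix _ _ _); exact: val_inj.
by rewrite row_mxEr.
Qed.

Lemma measurable_rV_cons m : measurable_fun setT (@rV_cons m).
Proof.
apply: measurable_fun_rV => i; case: (unliftP ord0 i) => [j|] ->.
  under eq_fun do rewrite rV_consS.
  exact: (measurableT_comp (measurable_coord j) measurable_snd).
by under eq_fun do rewrite rV_cons0; exact: measurable_fst.
Qed.

Lemma scale_rV_cons m t x (y : 'rV[R]_m) :
  t *: rV_cons (x, y) = rV_cons (t * x, t *: y).
Proof.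
apply/rowP => i; rewrite mxE; case: (unliftP ord0 i) => [j|] ->.
  by rewrite !rV_consS mxE.
by rewrite !rV_cons0.
Qed.

Lemma measurable_slice m (A : set 'rV[R]_m.+1) x : measurable A ->
  measurable [set y | A (rV_cons (x, y))].
Proof.
move=> mA; have mS : measurable (@rV_cons m @^-1` A).
  by rewrite -[X in measurable X]setTI; exact: measurable_rV_cons.
have := measurable_xsection x mS.
by congr measurable; apply/seteqP; split => y; rewrite /xsection/= inE.
Qed.

Lemma measurable_fun_slice m (A : set 'rV[R]_m.+1) : measurable A ->
  measurable_fun setT (fun x => borel_lebesgue [set y | A (rV_cons (x, y))]).
Proof.
move=> mA; have mS : measurable (@rV_cons m @^-1` A).
  by rewrite -[X in measurable X]setTI; exact: measurable_rV_cons.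
have := measurable_fun_xsection (@borel_lebesgue R m) mS.
congr measurable_fun; apply/funext => x /=; congr (borel_lebesgue _).
by apply/seteqP; split => y; rewrite /xsection/= inE.
Qed.

Lemma borel_lebesgueS m (A : set 'rV[R]_m.+1) :
  borel_lebesgue A = (\int[leb]_x borel_lebesgue [set y | A (rV_cons (x, y))])%E.
Proof. by []. Qed.

(** By induction on the dimension: the slices scale by [t ^+ n] and the
    one-dimensional integral over the first coordinate by [t]. *)
Lemma borel_lebesgue_dilation n t (A : set 'rV[R]_n) : 0 < t -> measurable A ->
  borel_lebesgue A = ((t ^+ n)%:E * borel_lebesgue [set x | A (t *: x)])%E.
Proof.
move=> t0; elim: n A => [|n IH] A mA.
  by rewrite expr0 mul1e; congr (borel_lebesgue _); apply/seteqP; split => x /=;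
    rewrite (_ : t *: x = x)//; apply/rowP => -[].
rewrite !borel_lebesgueS.
rewrite (ge0_integral_dilation t0); last 2 first.
- exact: measurable_fun_slice.
- by move=> x; exact: measure_ge0.
under eq_integral => x _ do rewrite (IH _ (measurable_slice (t * x) mA)).
rewrite ge0_integralZl//.
- rewrite muleA -EFinM exprS; congr (_ * _)%E; apply: eq_integral => x _.
  congr (borel_lebesgue _); apply/seteqP; split => y /=; by rewrite scale_rV_cons.
- rewrite (_ : (fun _ => _) = fun x =>
      borel_lebesgue [set y | [set z | A (t *: z)] (rV_cons (x, y))]); last first.
    apply/funext => x; congr (borel_lebesgue _).
    by apply/seteqP; split => y /=; rewrite scale_rV_cons.
  apply: measurable_fun_slice.
  rewrite -[X in measurable X]setTI.
  have : measurable_fun setT (fun x : 'rV[R]_n.+1 => t *: x).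
    apply: measurable_fun_rV => i; under eq_fun do rewrite mxE.
    by apply: measurable_funM => //; exact: measurable_coord.
  exact.
- by rewrite lee_fin exprn_ge0// ltW.
Qed.

Definition box n (u : 'rV[R]_n) (e : R) : set 'rV[R]_n :=
  [set x | forall i, `|x ord0 i - u ord0 i| <= e].

Lemma measurable_box n (u : 'rV[R]_n) e : measurable (box u e).
Proof.
have -> : box u e = \bigcap_(i in [set: 'I_n]) [set x | `|x ord0 i - u ord0 i| <= e].
  by apply/seteqP; split => x /= h i; [move=> _|]; exact: h.
apply: fin_bigcap_measurable => // i _.
have mf : measurable_fun setT (fun x : 'rV[R]_n => `|x ord0 i - u ord0 i|).
  by apply: measurableT_comp => //; apply: measurable_funB => //; exact: measurable_coord.
have := mf measurableT `]-oo, e]%classic (measurable_itv _).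
by rewrite setTI; congr measurable; apply/seteqP; split => x /=; rewrite in_itv.
Qed.

Lemma borel_lebesgue_box n (u : 'rV[R]_n) e : 0 < e ->
  borel_lebesgue (box u e) = ((2 * e) ^+ n)%:E.
Proof.
move=> e0; elim: n u => [|n IH] u.
  by rewrite /= diracE mem_set// => -[].
rewrite borel_lebesgueS.
pose u0 := u ord0 ord0; pose u' : 'rV[R]_n := \row_i u ord0 (lift ord0 i).
rewrite (_ : (fun x => _) = fun x : R =>
    (((2 * e) ^+ n)%:E * (\1_(`[u0 - e, u0 + e]%classic) x)%:E)%E); last first.
  apply/funext => x; rewrite indicE; case: (boolP (x \in _)) => [/set_mem|/negP] xI.
    rewrite mule1 -(IH u'); congr (borel_lebesgue _).
    apply/seteqP; split => y /= h i.
      by have := h (lift ord0 i); rewrite rV_consS mxE.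
    case: (unliftP ord0 i) => [j|] ->; first by rewrite rV_consS; have := h j; rewrite mxE.
    by rewrite rV_cons0 ler_distl; move: xI; rewrite /= in_itv.
  rewrite mule0 (_ : [set y | _] = set0) ?measure0//.
  apply/seteqP; split => y //= h; apply: xI; apply/mem_set.
  by have := h ord0; rewrite rV_cons0 ler_distl/= in_itv.
rewrite ge0_integralZl//; last 2 first.
- by apply/measurable_EFinP; exact: measurable_indic.
- by rewrite lee_fin exprn_ge0// mulr_ge0// ltW.
rewrite integral_indic// setIT.
have lebE : leb `[u0 - e, u0 + e]%classic = (2 * e)%:E.
  rewrite lebesgue_measure_itv/= lte_fin ltrD2l gtrN//= -EFinB.
  by congr EFin; lra.
by rewrite [X in (_ * X)%E]lebE -EFinM exprSr.
Qed.

End borel_rV.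

(** * Homogeneity and positivity of the weight *)

Section homogeneity.
Context {R : realType} {n : nat}.
Implicit Types x a : 'rV[R]_n.

Lemma measurable_rV_dotv a : measurable_fun setT (dotv a).
Proof.
apply: measurable_sum => i; apply: measurable_funM => //.
exact: measurable_coord.
Qed.

Lemma measurable_rV_enorm : measurable_fun setT (@enorm R n).
Proof.
apply: (@measurableT_comp _ _ _ _ _ _ (@Num.sqrt R)).
  by apply: continuous_measurable_fun; exact: sqrt_continuous.
apply: measurable_sum => i; apply: measurable_funM; exact: measurable_coord.
Qed.

Lemma measurable_rV_dunkl_weight (Phip : {fset 'rV[R]_n}) k :
  measurable_fun setT (dunkl_weight Phip k).
Proof.
apply: measurable_prod => a _.
apply: (measurableT_comp (@measurable_powR R (2 * k a)) _).
by apply: measurableT_comp => //; exact: measurable_rV_dotv.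
Qed.

Lemma enorm_ge0 x : 0 <= enorm x. Proof. exact: sqrtr_ge0. Qed.

Lemma dotvZr a t x : dotv a (t *: x) = t * dotv a x.
Proof. by rewrite /dotv mulr_sumr; apply: eq_bigr => i _; rewrite mxE mulrCA. Qed.

Lemma dotv_ge0 x : 0 <= dotv x x.
Proof. by apply: sumr_ge0 => i _; rewrite -expr2 sqr_ge0. Qed.

Lemma enorm_sqr x : enorm x ^+ 2 = dotv x x.
Proof. by rewrite sqr_sqrtr// dotv_ge0. Qed.

Lemma enormZ t x : 0 <= t -> enorm (t *: x) = t * enorm x.
Proof.
move=> t0; apply/eqP; rewrite -(@eqrXn2 _ 2)// ?mulr_ge0 ?enorm_ge0//.
rewrite exprMn !enorm_sqr; apply/eqP.
by rewrite /dotv mulr_sumr; apply: eq_bigr => i _; rewrite !mxE; ring.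
Qed.

Lemma powR_sum (t : R) (I : Type) (s : seq I) (F : I -> R) : 0 < t ->
  \prod_(i <- s) t `^ F i = t `^ (\sum_(i <- s) F i).
Proof.
move=> t0; elim: s => [|i s IH]; first by rewrite !big_nil powRr0.
by rewrite !big_cons IH powRD// [t == 0]gt_eqF ?implybT.
Qed.

Lemma dunkl_weightZ (Phip : {fset 'rV[R]_n}) k t x : 0 < t ->
  dunkl_weight Phip k (t *: x) =
  t `^ (2 * \sum_(a <- Phip) k a) * dunkl_weight Phip k x.
Proof.
move=> t0; rewrite /dunkl_weight mulr_sumr -powR_sum// -big_split/=.
apply: eq_bigr => a _.
by rewrite dotvZr normrM powRM// gtr0_norm.
Qed.

Lemma coord_le_enorm x i : `|x ord0 i| <= enorm x.
Proof.
rewrite -(@ler_pXn2r _ 2)// ?nnegrE ?enorm_ge0// enorm_sqr real_normK ?num_real//.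
rewrite /dotv (bigD1 i)//= -expr2 lerDl; apply: sumr_ge0 => j _.
by rewrite -expr2 sqr_ge0.
Qed.

Lemma norm_dotv_le a x r : (forall i, `|x ord0 i| <= r) ->
  `|dotv a x| <= r * \sum_i `|a ord0 i|.
Proof.
move=> xr; apply: le_trans (ler_norm_sum _ _ _) _.
rewrite mulr_sumr; apply: ler_sum => i _.
by rewrite normrM mulrC ler_wpM2r.
Qed.

Lemma dotvB a x y : dotv a (x - y) = dotv a x - dotv a y.
Proof.
by rewrite /dotv -sumrB; apply: eq_bigr => i _; rewrite !mxE mulrBr.
Qed.

Lemma dotvC a x : dotv a x = dotv x a.
Proof. by apply: eq_bigr => i _; rewrite mulrC. Qed.

(** For a single [a] the half-width [dotv a u / (S + 1)] works, with [S] the sum of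
    the [`|a i|]; a finite family takes the least of these. *)
Lemma box_dotv_gt0 (s : seq 'rV[R]_n) u : (forall a, a \in s -> 0 < dotv a u) ->
  exists2 e, 0 < e & forall a x, a \in s -> box u e x -> 0 < dotv a x.
Proof.
elim: s => [|a s IH] su; first by exists 1.
have [|e e0 He] := IH; first by move=> b bs; apply: su; rewrite inE bs orbT.
have au : 0 < dotv a u by apply: su; rewrite inE eqxx.
pose S := \sum_i `|a ord0 i|.
have S0 : 0 <= S by apply: sumr_ge0.
have S1 : 0 < S + 1 by rewrite ltr_wpDl.
exists (Num.min e (dotv a u / (S + 1))); first by rewrite lt_min e0 divr_gt0.
move=> b x; rewrite inE => /predU1P[->|bs] bx.
  have /norm_dotv_le xu : forall i, `|(x - u) ord0 i| <= dotv a u / (S + 1).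
    by move=> i; rewrite !mxE; apply: le_trans (bx i) _; rewrite ge_min lexx orbT.
  have /ler_normlP[+ _] := xu a; rewrite dotvB -/S opprB.
  rewrite lerBlDr -lerBlDl; apply: lt_le_trans; rewrite subr_gt0.
  by rewrite mulrAC ltr_pdivrMr// ltr_pM2l// ltrDl.
by apply: He => // i; apply: le_trans (bx i) _; rewrite ge_min lexx.
Qed.

End homogeneity.

Section completed_lebesgue.
Context {R : realType} {n : nat}.
Local Notation L := (lebesgue_rV_type R n).
Local Notation leb := (lebesgue_rV R n).

Lemma measurable_completed (d : measure_display) (T : measurableType d)
    (f : 'rV[R]_n -> T) :
  measurable_fun setT f -> measurable_fun setT (f : L -> T).
Proof.
move=> mf _ Y mY; rewrite setTI; apply: caratheodory_measurable_mu_ext.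
by rewrite -[X in measurable X]setTI; exact: mf.
Qed.

Lemma lebesgue_rV_borel (A : set 'rV[R]_n) : measurable A ->
  leb A = borel_lebesgue A.
Proof. by move=> mA; rewrite /lebesgue_rV /completed_measure_extension measurable_mu_extE. Qed.

(** Both measures agree on Borel sets, and [h] is Borel. *)
Lemma ge0_integral_completed (h : 'rV[R]_n -> \bar R) :
  measurable_fun setT h -> (forall x, 0 <= h x)%E ->
  (\int[leb]_x h x = \int[@borel_lebesgue R n]_x h x)%E.
Proof.
move=> mh h0.
have mid : measurable_fun setT ((fun x => x) : L -> 'rV[R]_n).
  by apply: measurable_completed.
have [nu [nuE nuI]] := image_measure_exists leb mid.
rewrite -nuI//; apply: eq_measure_integral => A mA _.
by rewrite nuE; exact: lebesgue_rV_borel.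
Qed.

Lemma ge0_integral_rV_dilation t (h : 'rV[R]_n -> \bar R) : 0 < t ->
  measurable_fun setT h -> (forall x, 0 <= h x)%E ->
  (\int[@borel_lebesgue R n]_x h x =
   (t ^+ n)%:E * \int[@borel_lebesgue R n]_x h (t *: x)%R)%E.
Proof.
move=> t0 mh h0.
have mt : measurable_fun setT (fun x : 'rV[R]_n => t *: x).
  apply: measurable_fun_rV => i; under eq_fun do rewrite mxE.
  by apply: measurable_funM => //; exact: measurable_coord.
have [nu [nuE nuI]] := image_measure_exists (@borel_lebesgue R n) mt.
have tn : 0 <= t ^+ n by rewrite exprn_ge0// ltW.
rewrite -nuI// -(ge0_integral_mscale _ _ (NngNum tn))//.
apply: eq_measure_integral => A mA _.
transitivity ((t ^+ n)%:E * nu A)%E; last by [].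
by rewrite nuE; exact: borel_lebesgue_dilation.
Qed.

End completed_lebesgue.

Section dunkl_weight_growth.
Context {R : realType} {n : nat} (Phip : {fset 'rV[R]_n}) (k : 'rV[R]_n -> R).
Hypothesis n0 : (0 < n)%N.
Hypothesis k0 : forall a, a \in Phip -> 0 <= k a.
(* For a positive subsystem this is the vector that defines it. *)
Hypothesis cone : exists u, forall a, a \in Phip -> 0 < dotv a u.
Local Notation L := (lebesgue_rV_type R n).
Local Notation leb := (lebesgue_rV R n).
Local Notation bleb := (@borel_lebesgue R n).
Local Notation w := (dunkl_weight Phip k).
Local Notation D := (dunkl_dim Phip k).

Lemma dunkl_dimE : D = n%:R + 2 * \sum_(a <- Phip) k a.
Proof. by rewrite /dunkl_dim /dunkl_lambda; lra. Qed.

Lemma dunkl_dim_gt0 : 0 < D.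
Proof.
rewrite dunkl_dimE ltr_wpDr ?ltr0n// mulr_ge0// big_seq.
by apply: sumr_ge0 => a /k0.
Qed.

Let ball r : set 'rV[R]_n := [set x | enorm x <= r].

Let mball r : measurable (ball r).
Proof.
have mf : measurable_fun setT (@enorm R n) by exact: measurable_rV_enorm.
have := mf measurableT `]-oo, r]%classic (measurable_itv _).
by rewrite setTI; congr measurable; apply/seteqP; split => x /=; rewrite in_itv.
Qed.

Let h r (x : 'rV[R]_n) : R := w x * \1_(ball r) x.

Let mh r : measurable_fun setT (h r).
Proof.
apply: measurable_funM; first exact: measurable_rV_dunkl_weight.
exact: measurable_indic.
Qed.

Let h0 r x : 0 <= h r x. Proof. by rewrite mulr_ge0 ?dunkl_weight_ge0. Qed.

(* The mass of a ball, computed with the Borel measure, for which the dilation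
   formula is available. *)
Let mass r : \bar R := (\int[bleb]_x (h r x)%:E)%E.

Let mass_ge0 r : (0 <= mass r)%E.
Proof. by apply: integral_ge0 => x _; rewrite lee_fin h0. Qed.

Let mass_homogeneous r : 0 < r -> mass r = ((r `^ D)%:E * mass 1%R)%E.
Proof.
move=> r0; rewrite /mass (ge0_integral_rV_dilation r0); last 2 first.
- by apply/measurable_EFinP; exact: mh.
- by move=> x; rewrite lee_fin h0.
have -> : r `^ D = r ^+ n * r `^ (2 * \sum_(a <- Phip) k a).
  rewrite dunkl_dimE powRD; last by rewrite [r == 0]gt_eqF ?implybT.
  by rewrite powR_mulrn// ltW.
rewrite EFinM -muleA; congr (_ * _)%E; rewrite -ge0_integralZl//; last 3 first.
- by apply/measurable_EFinP; exact: mh.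
- by move=> x _; rewrite lee_fin h0.
- by rewrite lee_fin powR_ge0.
apply: eq_integral => x _; rewrite -EFinM /h dunkl_weightZ// -mulrA; congr (_ * (_ * _))%:E.
rewrite !indicE; congr (nat_of_bool _)%:R.
apply/idP/idP => /set_mem; rewrite /ball/= => xr; apply/mem_set => /=.
  by rewrite enormZ ?(ltW r0)// in xr; rewrite -(@ler_pM2l _ r)// mulr1.
by rewrite enormZ ?(ltW r0)// -[leRHS]mulr1 ler_pM2l.
Qed.

(** The unit ball lies in a cube, on which each [`|dotv a x|] is at most the sum
    of the [`|a i|]. *)
Let mass1_fin : (mass 1%R < +oo)%E.
Proof.
pose M := \prod_(a <- Phip) ((\sum_i `|a ord0 i|) `^ (2 * k a)).
have M0 : 0 <= M by apply: prodr_ge0 => a _; exact: powR_ge0.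
have mb := measurable_box (0 : 'rV[R]_n) 1.
apply: (@le_lt_trans _ _ (\int[bleb]_x (M%:E * (\1_(box (0 : 'rV[R]_n) 1) x)%:E))%E).
  apply: ge0_le_integralT => x; first by rewrite lee_fin h0.
  rewrite -EFinM lee_fin /h !indicE.
  case: (boolP (x \in ball 1)) => [/set_mem x1|_]; last by rewrite mulr0 mulr_ge0.
  have xb i : `|x ord0 i| <= 1 by exact: le_trans (coord_le_enorm x i) x1.
  rewrite mem_set; last by move=> i; rewrite mxE subr0.
  rewrite !mulr1 /dunkl_weight /M big_seq [leRHS]big_seq; apply: ler_prod => a aP.
  rewrite powR_ge0/=; apply: ge0_ler_powR.
  - by rewrite mulr_ge0// k0.
  - by rewrite nnegrE.
  - by rewrite nnegrE; apply: sumr_ge0.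
  - by have := norm_dotv_le a xb; rewrite mul1r.
rewrite ge0_integralZl//; last by apply/measurable_EFinP; exact: measurable_indic.
rewrite integral_indic// setIT [X in (_ * X)%E](borel_lebesgue_box 0 ltr01).
by rewrite -EFinM ltry.
Qed.

(** The weight is positive on a cube inside the chamber. If the unit ball had no
    mass, by homogeneity no ball would, and the cube would be null. *)
Let mass1_gt0 : (0 < mass 1%R)%E.
Proof.
have [u uP] := cone.
have [|e e0 He] := box_dotv_gt0 (s := Phip) (u := u); first by move=> a; exact: uP.
pose rho := Num.sqrt (\sum_i (`|u ord0 i| + e) ^+ 2) + 1.
have rho0 : 0 < rho by rewrite ltr_wpDl// sqrtr_ge0.
have box_ball : box u e `<=` ball rho.
  move=> x xb; rewrite /ball/= /rho.
  apply: (@le_trans _ _ (Num.sqrt (\sum_i (`|u ord0 i| + e) ^+ 2))); last first.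
    by rewrite lerDl.
  apply: ler_wsqrtr; apply: ler_sum => i _.
  rewrite -expr2 -real_normK ?num_real// ler_pXn2r ?nnegrE ?addr_ge0 ?(ltW e0)//.
  have := ler_normD (x ord0 i - u ord0 i) (u ord0 i); rewrite subrK.
  by move/le_trans; apply; rewrite addrC lerD2l.
have w0 x : box u e x -> 0 < w x.
  move=> xb; rewrite /dunkl_weight big_seq; apply: prodr_gt0 => a aP.
  by apply: powR_gt0; rewrite normr_gt0 gt_eqF// He.
rewrite lt0e mass_ge0 andbT; apply/eqP => m1.
have mb := measurable_box u e.
have mwE : measurable_fun setT (EFin \o w).
  by apply/measurable_EFinP; exact: measurable_rV_dunkl_weight.
have : (\int[bleb]_(x in box u e) `|(w x)%:E| = 0)%E.
  apply/eqP; rewrite eq_le; apply/andP; split; last by apply: integral_ge0.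
  have <- : mass rho = 0%E by rewrite mass_homogeneous// m1 mule0.
  rewrite integral_mkcond; apply: ge0_le_integralT => x.
    by apply: erestrict_ge0.
  rewrite patchE; case: ifPn => [/set_mem xb|_]; last by rewrite lee_fin h0.
  rewrite /h indicE mem_set ?mulr1; last exact: box_ball.
  by rewrite abse_EFin ger0_norm ?dunkl_weight_ge0.
move/(ae_eq_integral_abs bleb mb (measurable_funTS mwE)) => ae0.
have : bleb (box u e) = 0%E.
  apply/negligibleP => //; apply: negligibleS ae0 => x xb /= /(_ xb) [] /eqP.
  by rewrite gt_eqF// w0.
rewrite borel_lebesgue_box// => -[] /eqP.
by rewrite expf_eq0 mulf_eq0 pnatr_eq0/= (gt_eqF e0) andbF.
Qed.

Lemma integral_dunkl_weight_ball : exists2 K, 0 < K & forall r, 0 <= r ->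
  (\int[leb]_(x in ([set x | enorm x <= r]%R : set L)) (w x)%:E = (K * r `^ D)%:E)%E.
Proof.
have m1fin : mass 1%R \is a fin_num by rewrite ge0_fin_numE.
exists (fine (mass 1%R)); first by rewrite fine_gt0// mass1_gt0.
move=> r r0.
have -> : (\int[leb]_(x in ([set x | enorm x <= r]%R : set L)) (w x)%:E = mass r)%E.
  rewrite /mass -ge0_integral_completed; last 2 first.
  - by apply/measurable_EFinP; exact: mh.
  - by move=> x; rewrite lee_fin h0.
  rewrite integral_mkcond; apply: eq_integral => x _.
  by rewrite patchE /h indicE; case: (_ \in _); rewrite ?mulr1 ?mulr0.
have massE e : 0 < e -> mass e = (fine (mass 1%R) * e `^ D)%:E.
  by move=> e0; rewrite mass_homogeneous// EFinM fineK// muleC.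
(* The origin lies in balls of arbitrarily small mass [e]. *)
move: r0; rewrite le_eqVlt => /predU1P[<-|]; last exact: massE.
rewrite powR0 ?mulr0; last by rewrite gt_eqF// dunkl_dim_gt0.
apply/eqP; rewrite eq_le mass_ge0 andbT; apply/lee_addgt0Pr => e e0.
have K0 : 0 < fine (mass 1%R) by rewrite fine_gt0// mass1_gt0.
pose t := (e / fine (mass 1%R)) `^ D^-1.
have t0 : 0 < t by rewrite powR_gt0// divr_gt0.
have <- : mass t = (0 + e%:E)%E.
  rewrite massE// /t -powRrM mulVf ?gt_eqF ?dunkl_dim_gt0// powRr1; last first.
    by rewrite divr_ge0 ?(ltW e0) ?(ltW K0).
  by rewrite add0e mulrCA divff ?mulr1// gt_eqF.
apply: ge0_le_integralT => x; first by rewrite lee_fin h0.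
rewrite lee_fin /h ler_wpM2l ?dunkl_weight_ge0// !indicE ler_nat.
case: (boolP (x \in ball 0)) => // /set_mem x0.
by rewrite mem_set//; exact: le_trans x0 (ltW t0).
Qed.

End dunkl_weight_growth.

(** * Positivity and finiteness of the Gamma function *)

Section gamma.
Context {R : realType}.
Local Notation leb := (@lebesgue_measure R).
Variable q : R.
Hypothesis q0 : 0 < q.

Let f (t : R) : R := t `^ (q - 1) * expR (- t).

Let f0 t : 0 <= f t. Proof. by rewrite mulr_ge0 ?powR_ge0 ?expR_ge0. Qed.

Let mf (A : set R) : measurable_fun A (fun t => (f t)%:E).
Proof.
apply/measurable_EFinP; apply: measurable_funTS; apply: measurable_funM.
  exact: measurable_powR.
by apply: measurableT_comp => //; exact: measurable_expR.
Qed.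

(** A factorial times the exponential dominates [t `^ (q + 1)], so the integrand is
    at most of order [t `^ (- 2)] at infinity. *)
Let tail : exists2 C, 0 <= C & forall t, 1 <= t -> f t <= C * t `^ (- 1 - 1).
Proof.
pose m := (Num.truncn (q + 1)).+1.
exists (m.+1)`!%:R => // t t1; have t0 : 0 < t by exact: lt_le_trans t1.
rewrite /f expRN ler_pdivrMr ?expR_gt0// mulrAC.
have -> : t `^ (- 1 - 1) = (t `^ 2)^-1 by rewrite -powRN; congr powR; lra.
rewrite ler_pdivlMr ?powR_gt0// -powRD; last by rewrite [t == 0]gt_eqF ?implybT.
have -> : q - 1 + 2 = q + 1 by lra.
apply: (@le_trans _ _ (t ^+ m.+1)).
  rewrite -powR_mulrn ?(ltW t0)//; apply: ler_powR => //.
  by apply: ltW; apply: lt_trans (truncnS_gt _) _; rewrite ltr_nat.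
rewrite mulrC -ler_pdivrMr ?ltr0n ?fact_gt0//.
apply: le_trans (expR_ge1Dxn m (ltW t0)).
by rewrite lerDr.
Qed.

Lemma integral_Gamma_fin :
  (\int[leb]_(t in `]0%R, +oo[) (f t)%:E < +oo)%E.
Proof.
have [C C0 fC] := tail.
apply: (@le_lt_trans _ _ (\int[leb]_(t in `]0%R, 1%R]) (t `^ (q - 1))%:E +
    C%:E * \int[leb]_(t in `[1%R, +oo[) (t `^ (- 1 - 1))%:E)%E).
  rewrite -ge0_integralZl//; last 2 first.
  - by apply/measurable_EFinP; apply: measurable_funTS; exact: measurable_powR.
  - by move=> t _; rewrite lee_fin powR_ge0.
  rewrite [X in (X + _)%E]integral_mkcond [X in (_ + X)%E]integral_mkcond.
  rewrite -ge0_integralD//; last 4 first.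
  - by move=> t _; apply: erestrict_ge0 => s _; rewrite lee_fin powR_ge0.
  - apply/(measurable_restrictT _ _).1 => //.
    by apply/measurable_EFinP; apply: measurable_funTS; exact: measurable_powR.
  - move=> t _; apply: erestrict_ge0 => s _.
    by rewrite mule_ge0 ?lee_fin ?powR_ge0.
  - apply/(measurable_restrictT _ _).1 => //; apply: measurable_funeM.
    by apply/measurable_EFinP; apply: measurable_funTS; exact: measurable_powR.
  rewrite [leLHS]integral_mkcond; apply: ge0_le_integralT => t.
    by apply: erestrict_ge0 => s _; rewrite lee_fin f0.
  rewrite !patchE !mem_setE !in_itv/= !andbT.
  have [t0|_] := ltP 0 t; last first.
    by rewrite add0e; case: ifP => _; rewrite // mule_ge0 ?lee_fin ?powR_ge0.
  have [t1|t1] := leP t 1 => /=.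
    apply: (@le_trans _ _ (t `^ (q - 1))%:E).
      rewrite lee_fin -[leRHS]mulr1 ler_wpM2l ?powR_ge0//.
      by rewrite -expR0 ler_expR oppr_le0 ltW.
    by rewrite leeDl//; case: ifP => _; rewrite // mule_ge0 ?lee_fin ?powR_ge0.
  by rewrite (ltW t1) add0e -EFinM lee_fin fC// ltW.
by rewrite integral_powR_itvoc// integral_powR_itvcy// -EFinM -EFinD ltry.
Qed.

Lemma Gamma_gt0 : 0 < Gamma q.
Proof.
rewrite /Gamma /Rintegral fine_gt0// integral_Gamma_fin andbT.
apply: (@lt_le_trans _ _ ((expR (- 1))%:E * (1 `^ q / q)%:E)%E).
  by rewrite -EFinM lte_fin mulr_gt0 ?expR_gt0// divr_gt0 ?powR_gt0.
rewrite -integral_powR_itvoc// -ge0_integralZl//; last 2 first.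
- by apply/measurable_EFinP; apply: measurable_funTS; exact: measurable_powR.
- by move=> t _; rewrite lee_fin powR_ge0.
rewrite [leLHS]integral_mkcond [leRHS]integral_mkcond.
apply: ge0_le_integralT => t.
  by apply: erestrict_ge0 => s _; rewrite mule_ge0 ?lee_fin ?expR_ge0 ?powR_ge0.
rewrite !patchE !mem_setE !in_itv/= andbT.
have [t0|//] := ltP 0 t; have [t1|_] /= := leP t 1; last by rewrite lee_fin f0.
by rewrite -EFinM lee_fin mulrC ler_wpM2l ?powR_ge0// ler_expR lerN2.
Qed.

End gamma.

(** * The mass of balls for the Dunkl measure, and the theorem *)

(** The balls have mass [K * r `^ D] for the weight alone. Hence, before
    normalization, the image of the measure under [tau x = `|x| ^ 2 / 2] has
    density [B * t `^ lam], and the integral of [expR (- tau)] is [B * Gamma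
    (lam + 1)] without a change of variables. The unknown [K] divides out. *)
Lemma dunkl_measure_ball (R : realType) (n : nat) (Phip : {fset 'rV[R]_n})
    (k : 'rV[R]_n -> R) :
  (0 < n)%N -> (forall a, a \in Phip -> 0 <= k a) ->
  (exists u, forall a, a \in Phip -> 0 < dotv a u) ->
  0 < dunkl_b Phip k /\ forall r, 0 <= r ->
    dunkl_measure Phip k [set x | enorm x <= r] =
    (dunkl_b Phip k / dunkl_dim Phip k * r `^ dunkl_dim Phip k)%:E.
Proof.
move=> n0 k0 cone; set D := dunkl_dim Phip k; set lam := dunkl_lambda Phip k.
have D0 : 0 < D by exact: dunkl_dim_gt0.
have lamD : lam + 1 = D / 2 by rewrite /D /dunkl_dim -/lam; lra.
have lam0 : 0 < lam + 1 by rewrite lamD divr_gt0.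
have Gam0 := Gamma_gt0 lam0.
have b0 : 0 < dunkl_b Phip k by rewrite invr_gt0 mulr_gt0// powR_gt0.
split=> // r r0.
have [K K0 KE] := integral_dunkl_weight_ball n0 k0 cone.
pose L := lebesgue_rV_type R n; pose leb := lebesgue_rV R n.
have mw := measurable_dunkl_weight Phip k.
have w0 := dunkl_weight_ge0 Phip k.
have menorm : measurable_fun setT (fun x : L => enorm x).
  by apply: measurable_completed; exact: measurable_rV_enorm.
have [v vE] := density_measure_exists leb mw w0.
pose tau (x : L) := enorm x ^+ 2 / 2.
have mtau : measurable_fun setT tau.
  apply: measurable_funM; last exact: measurable_cst.
  exact: measurable_funX menorm.
have tau0 x : 0 <= tau x by rewrite divr_ge0 ?sqr_ge0.
pose B := K * 2 `^ (lam + 1) * (lam + 1).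
have B0 : 0 < B by rewrite !mulr_gt0 ?powR_gt0.
have vtau t : 0 <= t -> v [set x | tau x <= t] = (B / (lam + 1) * t `^ (lam + 1))%:E.
  move=> t0; have t20 : 0 <= 2 * t by rewrite mulr_ge0.
  have -> : [set x | tau x <= t] = [set x : L | enorm x <= Num.sqrt (2 * t)].
    apply/seteqP; split => x /=; rewrite /tau ler_pdivrMr// [t * 2]mulrC => xt.
      rewrite -(@ler_pXn2r _ 2)// ?nnegrE ?enorm_ge0 ?sqrtr_ge0//.
      by rewrite (sqr_sqrtr t20).
    move: xt; rewrite -(@ler_pXn2r _ 2)// ?nnegrE ?enorm_ge0 ?sqrtr_ge0//.
    by rewrite (sqr_sqrtr t20).
  rewrite vE KE ?sqrtr_ge0//; congr EFin.
  rewrite -powR12_sqrt// -powRrM -/D mulrC.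
  rewrite (_ : 2^-1 * D = lam + 1); last by rewrite lamD mulrC.
  rewrite powRM// /B mulfK ?gt_eqF//.
  by rewrite mulrC mulrA.
have cE : dunkl_const Phip k = (B * Gamma (lam + 1))^-1.
  rewrite /dunkl_const /Gamma /Rintegral; congr (_^-1).
  have fB (X : \bar R) : fine (B%:E * X)%E = B * fine X.
    case: X => [x| |] //=; rewrite ?mulr0.
    - by rewrite gt0_muley ?lte_fin.
    - by rewrite gt0_muleNy ?lte_fin.
  rewrite -fB; congr fine.
  pose phi (t : R) : \bar R := (expR (- t))%:E.
  have mphi : measurable_fun setT phi.
    rewrite /phi; apply/measurable_EFinP.
    by apply: measurableT_comp => //; exact: measurable_expR.
  have phi0 t : (0 <= phi t)%E by rewrite lee_fin expR_ge0.
  transitivity (\int[leb]_x (phi (tau x) * (dunkl_weight Phip k x)%:E))%E.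
    by apply: eq_integral => x _; rewrite -EFinM.
  rewrite -(ge0_integral_density mw w0 (fun A _ => vE A)
    (measurableT_comp mphi mtau) (fun x => phi0 (tau x))).
  rewrite (ge0_integral_radial mtau tau0 lam0 (ltW B0) vtau mphi phi0).
  rewrite -ge0_integralZl//; last 3 first.
  - apply/measurable_EFinP; apply: measurable_funM.
      by apply: measurable_funTS; exact: measurable_powR.
    by apply: measurable_funTS; apply: measurableT_comp => //; exact: measurable_expR.
  - by move=> t _; rewrite lee_fin mulr_ge0 ?powR_ge0 ?expR_ge0.
  - by rewrite lee_fin ltW.
  apply: eq_integral => t _; rewrite /phi -!EFinM; congr EFin.
  by rewrite mulrC mulrA.
rewrite /dunkl_measure; under eq_integral do rewrite EFinM.
have mball : measurable ([set x : L | enorm x <= r] : set L).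
  rewrite (_ : mkset _ = setT `&` (fun x : L => enorm x) @^-1` `]-oo, r]%classic).
    exact: menorm.
  by rewrite setTI; apply/seteqP; split => x /=; rewrite in_itv.
have mwE : measurable_fun ([set x : L | enorm x <= r] : set L)
    (fun x => (dunkl_weight Phip k x)%:E).
  by apply/measurable_EFinP; exact: measurable_funTS.
rewrite (ge0_integralZl leb mball mwE); last 2 first.
- by move=> x _; rewrite lee_fin; exact: w0.
- by rewrite lee_fin; exact: dunkl_const_ge0.
rewrite (KE r r0) -EFinM; congr EFin; rewrite mulrA; congr (_ * _).
rewrite cE /dunkl_b -/lam /B powRD; last by rewrite pnatr_eq0 implybT.
rewrite powRr1// (_ : D = 2 * (lam + 1)); last by rewrite lamD mulrCA mulfV ?mulr1 ?pnatr_eq0.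
have P0 : 0 < 2 `^ lam by rewrite powR_gt0.
by field; rewrite !gt_eqF.
Qed.

Lemma fine_hoelder_conjugateV (R : realType) (p : \bar R) : (1 <= p)%E ->
  fine ((hoelder_conjugate p)^-1)%E = 1 - fine (p^-1)%E.
Proof.
move=> p1; have p0 : p != 0%E by rewrite gt_eqF// (lt_le_trans _ p1).
have := hoelder_conjugate_eq1 (lt_le_trans (ltNyr 1) p1) p0.
case: p p1 p0 => [p| |//] p1 p0.
- rewrite inver ifF; last by apply/negbTE; move: p0; rewrite eqe.
  by case: (_^-1)%E => [x| |]//= []; lra.
- by rewrite hoelder_conjugatey invey inve1 /= subr0.
Qed.

Theorem theorem3p1 (R : realType) (d : nat) (Phi Phip : {fset 'rV[R]_d})
    (k : 'rV[R]_d -> R) (p : \bar R) (a b : R) :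
  (0 < d)%N ->
  root_system Phi ->
  positive_subsystem Phi Phip ->
  multiplicity_function Phi k ->
  (1 <= p)%E ->
  let invp := fine (p^-1)%E in
  let invp' := fine ((hoelder_conjugate p)^-1)%E in
  let admissible := b * invp < a * invp' /\ a + b = dunkl_dim Phip k in
  let c := hardy_const Phip k a b p in
  (((c < +oo)%E /\ hardy_inequality Phip k a b p (fine c)) <-> admissible) /\
  (admissible -> c = (dunkl_b Phip k / (a * invp' - b * invp))%:E).
Proof.
move=> d0 _ [u _ PhipE] [kPhi _] p1 invp invp' admissible c.
have invp'E : invp' = 1 - invp by exact: fine_hoelder_conjugateV.
have k0 x : x \in Phip -> 0 <= k x by rewrite PhipE => /andP[/kPhi].
have cone : exists u, forall x, x \in Phip -> 0 < dotv x u.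
  by exists u => x; rewrite PhipE dotvC => /andP[].
have [b0 growth] := dunkl_measure_ball d0 k0 cone.
have D0 := dunkl_dim_gt0 d0 k0.
pose L := lebesgue_rV_type R d.
have menorm : measurable_fun setT (fun x : L => enorm x).
  by apply: measurable_completed; exact: measurable_rV_enorm.
have necessary C : hardy_inequality Phip k a b p C ->
    [/\ b * invp < a * (1 - invp), a + b = dunkl_dim Phip k &
      dunkl_b Phip k / (a * (1 - invp) - b * invp) <= C].
  move=> hardy.
  apply: (hardy_necessary menorm (@enorm_ge0 R d) D0 b0 growth p1) => f mf fin.
  exact: (hardy f mf fin).2.
have sufficient : admissible ->
    hardy_inequality Phip k a b p (dunkl_b Phip k / (a * invp' - b * invp)).
  rewrite /admissible invp'E => -[kap0 abD] f mf fin.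
  suff [intf le] :
      (forall x, (dunkl_measure Phip k).-integrable (hardy_ball x) (EFin \o f)) /\
      (weighted_norm Phip k (- a) p (hardy_op Phip k f) <=
        (dunkl_b Phip k / (a * (1 - invp) - b * invp))%:E *
        weighted_norm Phip k b p f)%E.
    by split => //; apply: nearW => x; exact: intf.
  have [[r pr]|py] : (exists r, p = r%:E) \/ p = +oo%E.
    by case: p p1 {invp invp' admissible c invp'E necessary kap0 fin} => [r| |] // _;
      [left; exists r|right].
    have invrE : invp = r^-1.
      by rewrite /invp pr inver gt_eqF// (lt_le_trans ltr01)// -lee_fin -pr.
    rewrite invrE in kap0 *; rewrite pr in p1 fin *.
    exact: (hardy_sufficient_real menorm (@enorm_ge0 R d) D0 b0 growth p1 abD kap0 mf fin).
  have invyE : invp = 0 by rewrite /invp py invey.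
  rewrite invyE subr0 mulr1 mulr0 in kap0 *; rewrite subr0 py in fin *.
  exact: (hardy_sufficient_infty menorm (@enorm_ge0 R d) D0 b0 growth abD kap0 mf fin).
have cE : admissible -> c = (dunkl_b Phip k / (a * invp' - b * invp))%:E.
  move=> adm; have hardy := sufficient adm.
  have kap0 : 0 < a * invp' - b * invp by rewrite subr_gt0; case: adm.
  apply/eqP; rewrite eq_le; apply/andP; split.
    apply: ereal_inf_lbound; exists (dunkl_b Phip k / (a * invp' - b * invp)) => //.
    by split => //; rewrite divr_ge0 ?(ltW b0) ?(ltW kap0).
  apply: le_ereal_inf_tmp => _ [C [_ /necessary[_ _ +]] <-].
  by rewrite lee_fin invp'E.
split=> //; split=> [[_ /necessary[]]|adm].
  by rewrite /admissible invp'E.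
by rewrite (cE adm) ltry; split => //; exact: sufficient.
Qed.
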